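(* Let $\mathcal{G}_1$ and $\mathcal{G}_2$ be effective ample minimal Hausdorff groupoids whose unit spaces have no isolated points. For $i=1,2$ let $\Gamma_i$ be a subgroup with $\mathsf{D}(\llbracket \mathcal{G}_i \rrbracket) \leq \Gamma_i \leq \llbracket \mathcal{G}_i \rrbracket$. If $\Gamma_1 \cong \Gamma_2$ as abstract groups, then $\mathcal{G}_1 \cong \mathcal{G}_2$ as topological groupoids. In particular, the following are equivalent: (1) $\mathcal{G}_1 \cong \mathcal{G}_2$ as topological groupoids; (2) $\llbracket \mathcal{G}_1 \rrbracket \cong \llbracket \mathcal{G}_2 \rrbracket$ as abstract groups; (3) $\mathsf{D}(\llbracket \mathcal{G}_1 \rrbracket) \cong \mathsf{D}(\llbracket \mathcal{G}_2 \rrbracket)$ as abstract groups.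
   Context: An étale groupoid is a topological groupoid $\mathcal{G}$ whose range map $r(g)=gg^{-1}$ (and hence source map $s(g)=g^{-1}g$) is a local homeomorphism; its unit space $\mathcal{G}^{(0)}$ carries the relative topology. $\mathcal{G}$ is ample if it is étale and $\mathcal{G}^{(0)}$ is Hausdorff with a basis of compact open sets. $\mathcal{G}$ is effective if the interior of the isotropy bundle $\{g \in \mathcal{G} : s(g)=r(g)\}$ equals $\mathcal{G}^{(0)}$. The $\mathcal{G}$-orbit of $x \in \mathcal{G}^{(0)}$ is $\{r(g): s(g)=x\}$; $\mathcal{G}$ is minimal if every orbit is dense in $\mathcal{G}^{(0)}$. A bisection is an open $U\subseteq \mathcal{G}$ on which $s$ and $r$ are injective; it is full if $s(U)=r(U)=\mathcal{G}^{(0)}$. For a bisection $U$, $\pi_U = r|_U\circ (s|_U)^{-1}\colon s(U)\to r(U)$. The support of a homeomorphism $\phi$ is the closure of $\{x : \phi(x)\neq x\}$. The topological full group $\llbracket \mathcal{G}\rrbracket$ is the subgroup of $\operatorname{Homeo}(\mathcal{G}^{(0)})$ consisting of all $\pi_U$ with $U$ a full bisection such that $\operatorname{supp}(\pi_U)$ is compact; $\mathsf{D}(\llbracket \mathcal{G}\rrbracket)$ denotes its commutator subgroup. An isomorphism of topological groupoids is a groupoid isomorphism that is a homeomorphism. *)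

(* Defs.v *)
From HB Require Import structures.
From mathcomp Require Import all_boot.
From mathcomp Require Import boolp classical_sets functions topology.

Set Implicit Arguments.
Unset Strict Implicit.
Unset Printing Implicit Defensive.

Local Open Scope classical_set_scope.

(* Groupoid data on a carrier G (Renault's arrow-only presentation):
   a composability relation (the set G^(2)), a multiplication (only
   meaningful on composable pairs) and an inversion. *)
Record groupoid_data (G : Type) := GroupoidData {
  gcomp : G -> G -> Prop;
  gmul  : G -> G -> G;
  ginv  : G -> G }.

Section Groupoids.
Context {G : topologicalType} (X : groupoid_data G).
Local Notation comp := (gcomp X).
Local Notation mul := (gmul X).
Local Notation inv := (ginv X).

Definition is_groupoid : Prop :=
  [/\ (forall g, inv (inv g) = g),
      (forall g h k, comp g h -> comp h k ->
          [/\ comp (mul g h) k, comp g (mul h k) &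
              mul (mul g h) k = mul g (mul h k)]),
      (forall g, comp (inv g) g) &
      (forall g h, comp g h ->
          mul (inv g) (mul g h) = h /\ mul (mul g h) (inv h) = g)].

Definition grng (g : G) : G := mul g (inv g).
Definition gsrc (g : G) : G := mul (inv g) g.
Definition unit_space : set G := range grng.

Definition relopen (A B : set G) : Prop := exists V, open V /\ B = V `&` A.

Definition topological_groupoid : Prop :=
  [/\ is_groupoid, continuous inv &
      {within [set p : G * G | comp p.1 p.2], continuous (fun p => mul p.1 p.2)}].

Definition local_homeo_onto (f : G -> G) (A : set G) : Prop :=
  forall g, exists U : set G,
    [/\ open U, U g, {in U &, injective f}, {within U, continuous f} &
        forall W, open W -> W `<=` U -> relopen A (f @` W)].

Definition etale : Prop :=
  topological_groupoid /\ local_homeo_onto grng unit_space.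

Definition hausdorff_groupoid : Prop := hausdorff_space G.

Definition ample : Prop :=
  [/\ etale,
      (forall x y, unit_space x -> unit_space y -> x <> y ->
         exists U V, [/\ open U, open V, U x, V y & U `&` V `&` unit_space = set0]) &
      (forall x V, unit_space x -> open V -> V x ->
         exists K, [/\ compact K, relopen unit_space K, K x & K `<=` V `&` unit_space])].

Definition isotropy : set G := [set g | gsrc g = grng g].

Definition effective : Prop := interior isotropy = unit_space.

Definition orbit (x : G) : set G := [set grng g | g in [set g | gsrc g = x]].

Definition minimal : Prop :=
  forall x, unit_space x -> unit_space `<=` closure (orbit x).

Definition no_isolated_units : Prop :=
  forall x, unit_space x -> forall V, open V -> V x ->
    exists y, [/\ V y, unit_space y & y <> x].

Definition bisection (U : set G) : Prop :=
  [/\ open U, {in U &, injective gsrc} & {in U &, injective grng}].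

Definition full_bisection (U : set G) : Prop :=
  [/\ bisection U, gsrc @` U = unit_space & grng @` U = unit_space].

(* elements of Homeo(G^(0)) are represented by maps G -> G that are the
   identity outside the unit space; f represents pi_U *)
Definition represents_pi (U : set G) (f : G -> G) : Prop :=
  (forall x, unit_space x -> exists g, [/\ U g, gsrc g = x & f x = grng g]) /\
  (forall x, ~ unit_space x -> f x = x).

Definition support (f : G -> G) : set G :=
  closure [set x | unit_space x /\ f x <> x] `&` unit_space.

Definition full_group : set (G -> G) :=
  [set f | exists U, [/\ full_bisection U, represents_pi U f & compact (support f)]].

Inductive derived_full_group : (G -> G) -> Prop :=
  | dfg_id : derived_full_group id
  | dfg_comm a b a' b' : full_group a -> full_group b ->
      a' \o a = id -> a \o a' = id -> b' \o b = id -> b \o b' = id ->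
      derived_full_group (a' \o b' \o a \o b)
  | dfg_mul f g : derived_full_group f -> derived_full_group g ->
      derived_full_group (f \o g)
  | dfg_inv f f' : derived_full_group f -> f' \o f = id -> f \o f' = id ->
      derived_full_group f'.

Definition derived_set : set (G -> G) := [set f | derived_full_group f].

End Groupoids.

Definition fun_subgroup {T : Type} (H : set (T -> T)) : Prop :=
  [/\ H id, (forall f g, H f -> H g -> H (f \o g)) &
      (forall f, H f -> exists f', [/\ H f', f' \o f = id & f \o f' = id])].

Definition group_iso {T1 T2 : Type} (H1 : set (T1 -> T1)) (H2 : set (T2 -> T2)) : Prop :=
  exists phi : (T1 -> T1) -> (T2 -> T2),
    [/\ (forall f, H1 f -> H2 (phi f)),
        (forall f g, H1 f -> H1 g -> phi f = phi g -> f = g),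
        (forall h, H2 h -> exists f, H1 f /\ phi f = h) &
        (forall f g, H1 f -> H1 g -> phi (f \o g) = phi f \o phi g)].

Definition groupoid_iso {G1 G2 : topologicalType}
  (X1 : groupoid_data G1) (X2 : groupoid_data G2) : Prop :=
  exists (Phi : G1 -> G2) (Psi : G2 -> G1),
    [/\ cancel Phi Psi /\ cancel Psi Phi, continuous Phi, continuous Psi,
        (forall g h, gcomp X1 g h <-> gcomp X2 (Phi g) (Phi h)) &
        (forall g h, gcomp X1 g h -> Phi (gmul X1 g h) = gmul X2 (Phi g) (Phi h))].

Definition good_groupoid {G : topologicalType} (X : groupoid_data G) : Prop :=
  [/\ effective X, ample X, minimal X, hausdorff_space G & no_isolated_units X].

(* Main.v *)
(** The space is recovered from the group by involutions (Fremlin, Matui).  Let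
    [Gam] be one of the intermediate groups, acting on the unit space, and let
    [t] be an involution of [Gam].  The involutions [s] of [Gam] that commute
    with [t] and with all their conjugates under the centralizer of [t] are
    those with [s x] in [{x, t x}] for all [x].  An element commuting with all of
    these has its square trivial on [supp t], and it is arbitrary off [supp t];
    hence the centralizer of all such squares is [{w | supp w <= supp t}].  So a
    group isomorphism [phi] preserves inclusions [supp w <= supp t].  Supports
    are compact open and those of involutions form a basis, so a point [x] is
    matched with the unique common point of all [supp (phi t)] with [x] in
    [supp t]; this is an equivariant homeomorphism of the unit spaces.
    By effectiveness an arrow is determined by its source and by the germ there
    of a homeomorphism; by minimality and the absence of isolated points every
    arrow is a germ of an element of the commutator subgroup.  Transporting
    germs along [phi] gives the isomorphism of groupoids. *)
Require Import Defs.
From mathcomp Require Import all_boot.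
From mathcomp Require Import boolp classical_sets functions topology.

Set Implicit Arguments.
Unset Strict Implicit.
Unset Printing Implicit Defensive.

Local Open Scope classical_set_scope.

(** * The rigid stabilizer of the support of an involution *)

Definition moved {T : Type} (f : T -> T) : set T := [set x | f x <> x].

Section Algebra.
Context {T : Type}.
Implicit Types (f g s t v w a c : T -> T) (B : set T) (Gam : set (T -> T)).

Definition inverse_pair f f' := f \o f' = id /\ f' \o f = id.

Lemma inverse_pair_inj f f' : inverse_pair f f' -> injective f.
Proof. by move=> [_ /(congr1 (@^~ _)) E] x y e; rewrite -(E x) -(E y) /= e. Qed.

Lemma inverse_pair_sym f f' : inverse_pair f f' -> inverse_pair f' f.
Proof. by case. Qed.

Lemma involution_pair t : t \o t = id -> inverse_pair t t.
Proof. by split. Qed.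

Lemma compK f f' : f \o f' = id -> forall x, f (f' x) = x.
Proof. by move=> /(congr1 (@^~ _)) E x; exact: E. Qed.

Lemma inverse_pair_comp f f' g g' :
  inverse_pair f f' -> inverse_pair g g' -> inverse_pair (f \o g) (g' \o f').
Proof.
move=> [f1 f2] [g1 g2]; split; apply/funext => x /=.
- by rewrite (compK g1) (compK f1).
- by rewrite (compK f2) (compK g2).
Qed.

Lemma moved_inj f x : injective f -> moved f x -> moved f (f x).
Proof. by move=> fi fx /fi. Qed.

Lemma notin_moved f x : ~ moved f x -> f x = x.
Proof. by move=> /contrapT. Qed.

Lemma exists_moved f : f <> id -> exists x, moved f x.
Proof.
move=> nf; apply: contrapT => H; apply: nf; apply/funext => x.
by apply: notin_moved => m; apply: H; exists x.
Qed.

Lemma moved_inverse f f' : inverse_pair f f' -> moved f' = moved f.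
Proof.
move=> [e1 e2]; apply/seteqP; split => x m e; apply: m.
- by rewrite -{1}e (compK e2).
- by rewrite -{1}e (compK e1).
Qed.

(** An injective [f] maps [moved f] into itself, so a point moved by [f] and its image are both
    fixed by [g]; likewise with the roles exchanged. *)
Lemma disjoint_moved_commute f g : injective f -> injective g ->
  (forall x, moved f x -> ~ moved g x) -> f \o g = g \o f.
Proof.
move=> fi gi fg; apply/funext => x /=.
have [e|mf] := pselect (f x = x).
  have [e'|mg] := pselect (g x = x); first by rewrite e' e e'.
  rewrite e; apply: notin_moved => m; apply: fg m _; exact: moved_inj.
rewrite (notin_moved (fg _ mf)) (notin_moved (fg _ _)) //; exact: moved_inj.
Qed.

(* When [Gam] is rich and [t] is an involution, [inv_part] holds of the
   involutions [s] with [s x] in [{x, t x}], [inv_cent] of the elements [v] with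
   [v x] in [{x, t x}] on the support of [t], and [rigid] of the elements
   supported in the support of [t]. *)
Definition inv_part Gam t s := [/\ Gam s, s \o s = id &
  forall a a', Gam a -> Gam a' -> inverse_pair a a' -> a \o t = t \o a ->
    s \o (a \o s \o a') = (a \o s \o a') \o s] /\ s \o t = t \o s.

Definition inv_cent Gam t v :=
  Gam v /\ forall s, inv_part Gam t s -> v \o s = s \o v.

Definition rigid Gam t w :=
  Gam w /\ forall v, inv_cent Gam t v -> w \o (v \o v) = (v \o v) \o w.

Definition local_at t s := forall z, s z = z \/ s z = t z.

(** Both involutions preserve each orbit [{z, t z}], and permutations of at most two points
    commute. *)
Lemma local_commute t s1 s2 : t \o t = id -> s1 \o s1 = id -> s2 \o s2 = id ->
  local_at t s1 -> local_at t s2 -> s1 \o s2 = s2 \o s1.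
Proof.
move=> tt ss1 ss2.
suff W r1 r2 z : r1 \o r1 = id -> local_at t r1 -> r1 z = z -> r2 z = t z ->
    r1 (r2 z) = r2 (r1 z).
  move=> l1 l2; apply/funext => z /=.
  case: (l1 z) => e1; case: (l2 z) => e2.
  - by rewrite !(e1, e2).
  - exact: (W s1 s2 z ss1 l1 e1 e2).
  - exact: (esym (W s2 s1 z ss2 l2 e2 e1)).
  - by rewrite e2 -e1 (compK ss1) e1 -e2 (compK ss2).
(* If [r1] fixes [z], it fixes [t z] as well: the alternative [r1 (t z) = z] forces [t z = z]. *)
move=> rr l e1 e2; rewrite e1 e2.
have [//|] := l (t z); rewrite (compK tt) => e.
have : t z = z by rewrite -[LHS](compK rr) e e1.
by move=> ->.
Qed.

(* [a] acts as [c] on [B] and trivially on [s B], so evaluating the commutation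
   relation on [B] gives [c = c^-1] there. *)
Lemma conj_square s c c' a a' B :
  s \o s = id -> inverse_pair c c' -> moved c `<=` B ->
  (forall b, B b -> a b = c b) -> (forall b, B b -> a' b = c' b) ->
  (forall b, B b -> a (s b) = s b) -> (forall b, B b -> a' (s b) = s b) ->
  s \o (a \o s \o a') = (a \o s \o a') \o s -> c \o c = id.
Proof.
move=> ss cc cB ac ac' as_ as' /funeqP E; apply/funext => z /=.
have [Bz|nB] := pselect (B z); last first.
  by rewrite !(@notin_moved c) //; move=> /cB; rewrite ?(@notin_moved c) // => /cB.
have Bz' : B (c' z).
  apply: contrapT => n; have e : c (c' z) = c' z.
    by apply: notin_moved => /cB.
  by apply: n; rewrite -e (compK cc.1).
have := E z; rewrite /= (as' z) // (compK ss) (ac z) // (ac' z) // (as_ (c' z)) // (compK ss) => <-.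
by rewrite (compK cc.1).
Qed.

Lemma commutator_fixed a (b : T -> T) (x : T) : a \o a = id -> b \o b = id ->
  a x = x -> b x = x -> (a \o b \o a \o b) x = x.
Proof. by move=> aa bb ax bx; rewrite /= bx ax bx. Qed.

(** The conjugate [b a b] moves only the [b]-image of [moved a], which is disjoint from [moved a].
    The commutator is thus a product of two commuting involutions, at most one of which acts at any
    given point. *)
Lemma commutator_disjoint a (b : T -> T) : a \o a = id -> b \o b = id ->
  (forall x, moved a x -> ~ moved a (b x)) ->
  [/\ (a \o b \o a \o b) \o (a \o b \o a \o b) = id,
      a \o (b \o a \o b) = (b \o a \o b) \o a &
      forall x, (a \o b \o a \o b) x = a x \/ (a \o b \o a \o b) x = b (a (b x))].
Proof.
move=> aa bb ab.
have abs : a \o (b \o a \o b) = (b \o a \o b) \o a.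
  apply: disjoint_moved_commute.
  - exact: inverse_pair_inj (involution_pair aa).
  - apply: (inverse_pair_inj (f' := b \o a \o b)); apply: involution_pair.
    by apply/funext => x /=; rewrite (compK bb) (compK aa) (compK bb).
  - move=> x /ab n m; apply: n => e; apply: m.
    by rewrite /= e (compK bb).
have E x : a (b (a (b x))) = b (a (b (a x))) by exact: (congr1 (@^~ x) abs).
split=> // [|x].
  apply/funext => x /=.
  by rewrite (E (a (b (a (b x))))) (compK aa) (compK bb) (compK aa) (compK bb).
have [e|m] := pselect (a x = x); last first.
  left => /=; rewrite E.
  have /contrapT e : ~ moved a (b (a x)).
    by apply: ab; apply: moved_inj m; exact: inverse_pair_inj (involution_pair aa).
  by rewrite e (compK bb).
by right => /=; rewrite E e.
Qed.

End Algebra.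

(** * Separation and moved points in Hausdorff spaces *)

Section Topology.
Context {T : topologicalType}.
Hypothesis hT : hausdorff_space T.
Implicit Types (f g s t v w a c : T -> T) (x y z : T) (A B : set T).

Lemma separate x y : x <> y -> exists A B,
  [/\ open A, open B, A x, B y & forall z, A z -> ~ B z].
Proof.
move=> /eqP xy; have := hT; rewrite open_hausdorff => /(_ x y xy).
move=> [[A B]] /= [/set_mem Ax /set_mem By] [oA oB /eqP e].
by exists A, B; split=> // z Az Bz; have : (A `&` B) z by []; rewrite e.
Qed.

Lemma open_preimage (U : topologicalType) (f : T -> U) (B : set U) :
  continuous f -> open B -> open (f @^-1` B).
Proof. by move=> /continuousP cf /cf. Qed.

Lemma open_nearP A : (forall x, A x -> exists B, [/\ open B, B x & B `<=` A]) -> open A.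
Proof.
move=> H; rewrite openE => x /H [B [oB Bx BA]].
by rewrite /interior nbhsE; exists B.
Qed.

Lemma open_moved f : continuous f -> open (moved f).
Proof.
move=> cf; rewrite openE => x /separate [A [B [oA oB Ax By AB]]].
rewrite /interior nbhsE; exists (f @^-1` A `&` B) => [|y [/= fy By'] e].
  by split=> //; apply: openI => //; exact: open_preimage.
by apply: AB fy _; rewrite e.
Qed.

Lemma closure_open_meets A B x : closure A x -> open B -> B x -> exists2 y, A y & B y.
Proof. by move=> cA oB Bx; have [y []] := cA B (open_nbhs_nbhs (conj oB Bx)); exists y. Qed.

Lemma open_subset_nbhs A x : nbhs x A -> exists B, [/\ open B, B x & B `<=` A].
Proof. by rewrite nbhsE => -[B [oB Bx] BA]; exists B. Qed.

End Topology.

(** The dynamical facts on which the recovery of the space rests, isolated from groupoids; [X]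
    stands for the unit space. The field [rich_local_part] supplies nontrivial pieces of an
    involution near a given point, and [rich_noninvolution] supplies local test elements that are
    detected by their squares. *)
Record locally_rich {T : topologicalType} (X : set T) (Gam : set (T -> T)) : Prop :=
  LocallyRich {
    rich_group : fun_subgroup Gam;
    rich_continuous : forall f, Gam f -> continuous f;
    rich_support_sub : forall f, Gam f -> closure (moved f) `<=` X;
    rich_support_open : forall f, Gam f -> open (closure (moved f));
    rich_support_compact : forall f, Gam f -> compact (closure (moved f));
    rich_involution : forall x B, X x -> open B -> B x ->
      exists t, [/\ Gam t, t \o t = id, t x <> x & closure (moved t) `<=` B];
    rich_local_part : forall t x B, Gam t -> t \o t = id -> t x <> x ->
      open B -> B x -> exists s, [/\ Gam s, s <> id, s \o s = id, local_at t s &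
        moved s `<=` B `|` t @^-1` B];
    rich_noninvolution : forall x B, X x -> open B -> B x ->
      exists c, [/\ Gam c, c \o c <> id & moved c `<=` B] }.

Section RigidStabilizers.
Context {T : topologicalType} (X : set T) (Gam : set (T -> T)).
Hypotheses (hT : hausdorff_space T) (rich : locally_rich X Gam).
Implicit Types (f g s t v w a c : T -> T) (x y z : T) (A B : set T).

Let gr := rich_group rich.
Let cont := rich_continuous rich.

Lemma rich_comp f g : Gam f -> Gam g -> Gam (f \o g).
Proof. by case: gr => _ + _; apply. Qed.

Lemma rich_inverse f : Gam f -> exists2 f', Gam f' & inverse_pair f f'.
Proof. by case: gr => _ _ + Gf => /(_ f Gf) [f' [? ? ?]]; exists f'. Qed.

Lemma rich_inj f : Gam f -> injective f.
Proof. by move=> /rich_inverse [f' _]; exact: inverse_pair_inj. Qed.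

Lemma rich_moved_sub f : Gam f -> moved f `<=` X.
Proof. by move=> /(rich_support_sub rich) h; apply: subset_trans h; exact: subset_closure. Qed.

(** If [s z] avoids [z] and [t z], a non-involution [c] supported near [z] yields an element [a]
    commuting with [t] that equals [c] near [z] and is trivial near [s z]. Commutation of [s] with
    its conjugate by [a] then gives [c \o c = id] through [conj_square]. *)
Lemma inv_part_local t s : Gam t -> t \o t = id -> inv_part Gam t s -> local_at t s.
Proof.
move=> Gt tt [[Gs ss cj] st] z.
apply: contrapT => /not_orP [sz stz].
(* The inequalities on [s z] are open conditions, so a point in the closure of [moved t] can be
   replaced by a nearby point of [moved t]. *)
wlog tz : z sz stz / t z <> z \/ ~ closure (moved t) z.
  move=> W; have [cz|] := pselect (closure (moved t) z); last first.
    by move=> ?; apply: (W z) => //; right.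
  have oD : open (moved s `&` [set y | s y <> t y]).
    apply: openI; first exact: (open_moved hT (cont Gs)).
    have -> : [set y | s y <> t y] = moved (t \o s).
      apply/seteqP; split => y n e; apply: n.
        by rewrite -[LHS](compK tt); congr (t _); exact: e.
      by rewrite /= e (compK tt).
    by apply: open_moved => //; apply: cont; apply: rich_comp.
  have [y ty [sy sty]] := closure_open_meets cz oD (conj sz stz).
  by apply: (W y) => //; left.
have [A1 [A3 [o1 o3 A1z A3z A13]]] := separate hT (nesym sz).
have Xz : X z by apply: (rich_moved_sub Gs).
have cs := cont Gs; have ct := cont Gt.
case: tz => tz.
- have [A1' [A2 [o1' o2 A1z' A2z A12]]] := separate hT (nesym tz).
  have [A2' [A3' [o2' o3' A2z' A3z' A23]]] := separate hT (nesym stz).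
  (* The sets [B], [t B] and [s B] are pairwise disjoint. *)
  set B := (A1 `&` A1') `&` t @^-1` (A2 `&` A2') `&` s @^-1` (A3 `&` A3').
  have [c [Gc cc cB]] : exists c, [/\ Gam c, c \o c <> id & moved c `<=` B].
    apply: (rich_noninvolution rich Xz) => //.
    by rewrite /B; do !apply: openI => //; apply: open_preimage => //; apply: openI.
  have [c' Gc' icc] := rich_inverse Gc.
  have cB' : moved c' `<=` B by rewrite (moved_inverse icc).
  have itt := involution_pair tt.
  have commc d : Gam d -> moved d `<=` B -> d \o (t \o d \o t) = (t \o d \o t) \o d.
    move=> Gd dB; apply: disjoint_moved_commute.
    - exact: rich_inj.
    - exact: (rich_inj (rich_comp (rich_comp Gt Gd) Gt)).
    - move=> x /dB [[[_ x1] _] _] mx; have /dB [[_ [x2 _]] _] : moved d (t x).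
        by move=> e; apply: mx; rewrite /= e (compK tt).
      by move: x2; rewrite /= (compK tt) => /A12; apply.
  (* The symmetrized element [c t c t] commutes with [t], acts as [c] on [B], and is trivial on
     [s B]. *)
  apply: cc; apply: (@conj_square _ s c c' (c \o (t \o c \o t)) (t \o c' \o t \o c') B) => //.
  + move=> b [[_ [b2 _]] _] /=; rewrite (@notin_moved _ c (t b)) ?(compK tt) //.
    by move=> /cB [[[_ b1] _] _]; exact: A12 b1 b2.
  + move=> b Bb /=.
    have B' : B (c' b).
      apply: contrapT => n; apply: (n); rewrite -[c' b](notin_moved (f := c)).
        by rewrite (compK icc.1).
      by move=> /cB.
    rewrite (@notin_moved _ c' (t (c' b))) ?(compK tt) //.
    by move=> /cB' [[[_ b1] _] _]; case: B' => [[_ [b2 _]] _]; exact: A12 b1 b2.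
  + move=> b [_ [b3 b3']] /=; rewrite (@notin_moved _ c (t (s b))); last first.
      by move=> /cB [[_ [_ h2]] _]; move: h2; rewrite /= (compK tt) => /A23; apply.
    rewrite (compK tt) (@notin_moved _ c) // => /cB [[[h1 _] _] _]; exact: A13 h1 b3.
  + move=> b [_ [b3 b3']] /=.
    rewrite (@notin_moved _ c' (s b)); last by move=> /cB' [[[h1 _] _] _]; exact: A13 h1 b3.
    rewrite (@notin_moved _ c' (t (s b))) ?(compK tt) //.
    by move=> /cB' [[_ [_ h2]] _]; move: h2; rewrite /= (compK tt) => /A23; apply.
  + apply: cj.
    * exact: (rich_comp Gc (rich_comp (rich_comp Gt Gc) Gt)).
    * exact: (rich_comp (rich_comp (rich_comp Gt Gc') Gt) Gc').
    * have := inverse_pair_comp icc (inverse_pair_comp (inverse_pair_comp itt icc) itt).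
      by congr inverse_pair.
    * have /funeqP E := commc _ Gc cB; apply/funext => x; exact: (E (t x)).
(* Off the support of [t], the element [c] itself commutes with [t] and serves as [a]. *)
- set B := A1 `&` s @^-1` A3 `&` ~` closure (moved t).
  have [c [Gc cc cB]] : exists c, [/\ Gam c, c \o c <> id & moved c `<=` B].
    apply: (rich_noninvolution rich Xz) => //.
    apply: openI; last by apply: closed_openC; exact: closed_closure.
    by apply: openI => //; exact: open_preimage.
  have [c' Gc' icc] := rich_inverse Gc.
  have cB' : moved c' `<=` B by rewrite (moved_inverse icc).
  apply: cc; apply: (@conj_square _ s c c' c c' B) => //.
  + by move=> b [[_ b3] _]; apply: notin_moved => /cB [[h1 _] _]; exact: A13 h1 b3.
  + by move=> b [[_ b3] _]; apply: notin_moved => /cB' [[h1 _] _]; exact: A13 h1 b3.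
  + apply: cj => //; apply: disjoint_moved_commute; try exact: rich_inj.
    by move=> x /cB [_ n] m; apply: n; apply: subset_closure.
Qed.

(** A conjugate of [s] by an element commuting with [t] is again local at [t], so [local_commute]
    applies to the pair. *)
Lemma local_inv_part t s : Gam s -> t \o t = id -> s \o s = id ->
  local_at t s -> inv_part Gam t s.
Proof.
move=> Gs tt ss l.
have lt : local_at t t by move=> z; right.
split; last exact: local_commute lt.
split=> // a a' Ga Ga' [i1 i2] /funeqP at_; apply: (local_commute tt) => //.
- apply/funext => z /=.
  by rewrite (compK i2) (compK ss) (compK i1).
- move=> z /=; case: (l (a' z)) => ->; first by left; rewrite (compK i1).
  by right; have := at_ (a' z); rewrite /= (compK i1).
Qed.

(** Otherwise take a small nontrivial piece [s] of [t] near [z]. Since [v] commutes with [s] it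
    preserves [moved s], yet it carries the part of [moved s] near [z] away from both [B] and
    [t B]. *)
Lemma inv_cent_local t v z : Gam t -> t \o t = id -> inv_cent Gam t v ->
  t z <> z -> v z = z \/ v z = t z.
Proof.
move=> Gt tt [Gv vs] tz; apply: contrapT => /not_orP [vz vtz].
have [A1 [A3 [o1 o3 A1z A3z A13]]] := separate hT (nesym vz).
have [A1' [A2 [o1' o2 A1z' A2z A12]]] := separate hT (nesym tz).
have [A2' [A3' [o2' o3' A2z' A3z' A23]]] := separate hT (nesym vtz).
set B := (A1 `&` A1') `&` t @^-1` (A2 `&` A2') `&` v @^-1` (A3 `&` A3').
have cv := cont Gv; have ct := cont Gt.
have [s [Gs s1 ss l sB]] : exists s, [/\ Gam s, s <> id, s \o s = id, local_at t s &
        moved s `<=` B `|` t @^-1` B].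
  apply: (rich_local_part rich Gt tt tz) => //.
  by rewrite /B; do !apply: openI => //; apply: open_preimage => //; apply: openI.
(* The points moved by [s] come in pairs [p], [t p], one of which lies in [B]. *)
have [p Bp sp] : exists2 p, B p & s p <> p.
  have /existsNP [p sp] : ~ forall p, s p = p by move=> e; apply: s1; apply/funext.
  have [//|e] := l p; have [Bp|Bp] := sB _ sp; first by exists p.
  by exists (t p) => // e'; apply: sp; rewrite e -e' -e (compK ss).
have ip := local_inv_part Gs tt ss l.
have /funeqP/(_ p) /= := vs _ ip.
rewrite (@notin_moved _ s (v p)); first by move=> /(rich_inj Gv).
case: Bp => _ [/= b3 b3'] /sB [[[[h1 _] _] _]|[[[_ _] [_ h2]] _]]; first exact: A13 h1 b3.
by move: h2; rewrite /= (compK tt) => /A23; apply.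
Qed.

(** On [moved t] the injective map [v] permutes each pair [{y, t y}], so its square is trivial
    there; as [moved (v \o v)] is open, this extends to the closure. *)
Lemma inv_cent_square t v z : Gam t -> t \o t = id -> inv_cent Gam t v ->
  closure (moved t) z -> v (v z) = z.
Proof.
move=> Gt tt iv cz; apply: contrapT => n.
have Gv : Gam v by case: iv.
have oD : open (moved (v \o v)).
  by apply: open_moved => //; apply: cont; apply: rich_comp.
have [y ty] := closure_open_meets cz oD n; apply => /=.
have [e|e] := inv_cent_local Gt tt iv ty; first by rewrite !e.
have ty' : moved t (t y) by apply: moved_inj ty; exact: rich_inj.
have [e'|e'] := inv_cent_local Gt tt iv ty'; rewrite e e' ?(compK tt) //.
by case: ty; apply: (rich_inj Gv); rewrite e e'.
Qed.

(** This turns inclusion of supports into a condition on the abstract group. If [w] moved a point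
    off the support of [t], a non-involution [c] near that point would lie in [inv_cent], while [w]
    would carry the support of [c] off itself and so could not commute with [c \o c]. *)
Lemma rigidP t w : Gam t -> t \o t = id ->
  rigid Gam t w <-> Gam w /\ moved w `<=` closure (moved t).
Proof.
move=> Gt tt; split=> -[Gw H]; split=> //; last first.
  move=> v iv; have Gv : Gam v by case: iv.
  apply: disjoint_moved_commute; first exact: rich_inj.
    by apply: rich_inj; apply: rich_comp.
  by move=> x /H cx; apply; apply: inv_cent_square iv cx.
move=> z wz; apply: contrapT => nz.
have [A1 [A3 [o1 o3 A1z A3z A13]]] := separate hT (nesym wz).
set B := A1 `&` w @^-1` A3 `&` ~` closure (moved t).
have [c [Gc cc cB]] : exists c, [/\ Gam c, c \o c <> id & moved c `<=` B].
  apply: (rich_noninvolution rich (rich_moved_sub Gw wz)) => //.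
  apply: openI; last by apply: closed_openC; exact: closed_closure.
  by apply: openI => //; apply: open_preimage => //; exact: cont.
(* The elements of [inv_part] move only points moved by [t], hence none near [z]. *)
have icc : inv_cent Gam t c.
  split=> // s ips; apply: disjoint_moved_commute; first exact: rich_inj.
    by apply: rich_inj; case: ips => -[].
  move=> x /cB [_ nx] m; apply: nx; apply: subset_closure => e; apply: m.
  by case: (inv_part_local Gt tt ips x) => // ->.
have /existsNP [p cp] : ~ forall p, c (c p) = p by move=> e; apply: cc; apply/funext.
have [[_ p3] _] : B p by apply: cB => e; apply: cp; rewrite !e.
have := H _ icc => /funeqP/(_ p) /=.
have e : c (w p) = w p by apply: notin_moved => /cB [[h1 _] _]; exact: A13 h1 p3.
by rewrite !e => /(rich_inj Gw).
Qed.

End RigidStabilizers.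

(** * Spatial realization of group isomorphisms *)

(** The inverse is carried along explicitly and the conditions are symmetric, so that every
    transport lemma also applies to [psi]. Both maps are total but constrained only on the
    groups. *)
Record mutual_iso {T1 T2 : Type} (Gam1 : set (T1 -> T1)) (Gam2 : set (T2 -> T2))
    (phi : (T1 -> T1) -> T2 -> T2) (psi : (T2 -> T2) -> T1 -> T1) : Prop :=
  MutualIso {
    iso_fwd : forall f, Gam1 f -> Gam2 (phi f);
    iso_bwd : forall f, Gam2 f -> Gam1 (psi f);
    iso_fwdK : forall f, Gam1 f -> psi (phi f) = f;
    iso_bwdK : forall f, Gam2 f -> phi (psi f) = f;
    iso_comp : forall f g, Gam1 f -> Gam1 g -> phi (f \o g) = phi f \o phi g;
    iso_comp_bwd : forall f g, Gam2 f -> Gam2 g -> psi (f \o g) = psi f \o psi g;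
    iso_id : phi id = id;
    iso_id_bwd : psi id = id }.

Lemma mutual_iso_sym {T1 T2 : Type} (Gam1 : set (T1 -> T1)) (Gam2 : set (T2 -> T2))
    phi psi : mutual_iso Gam1 Gam2 phi psi -> mutual_iso Gam2 Gam1 psi phi.
Proof. by case. Qed.

Lemma group_iso_mutual {T1 T2 : Type} (Gam1 : set (T1 -> T1)) (Gam2 : set (T2 -> T2)) :
  fun_subgroup Gam1 -> fun_subgroup Gam2 -> group_iso Gam1 Gam2 ->
  exists phi psi, mutual_iso Gam1 Gam2 phi psi.
Proof.
move=> [i1 c1 _] [i2 c2 v2] [phi [fwd inj sur comp]].
have /choice [psi psiP] : forall h, exists f, Gam2 h -> Gam1 f /\ phi f = h.
  move=> h; have [/sur [f ?]|?] := pselect (Gam2 h); first by exists f.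
  by exists id.
have K f : Gam1 f -> psi (phi f) = f.
  by move=> Gf; have [? ?] := psiP _ (fwd _ Gf); apply: inj.
(* [phi id] is idempotent and has the left inverse [u]. *)
have phi1 : phi id = id.
  have [u [_ u1 _]] := v2 _ (fwd _ i1).
  have /(congr1 (fun h => u \o h)) : phi id \o phi id = phi id by rewrite -comp.
  by rewrite compA u1.
exists phi, psi; split => //.
- by move=> f /psiP [].
- by move=> f /psiP [].
- move=> f g Gf Gg; have [? e] := psiP _ Gf; have [? e'] := psiP _ Gg.
  have [? e''] := psiP _ (c2 _ _ Gf Gg).
  by apply: inj => //; [exact: c1 | rewrite comp // e e' e''].
- by rewrite -{1}phi1 K.
Qed.

Section AlgebraTransport.
Context {T1 T2 : Type} (Gam1 : set (T1 -> T1)) (Gam2 : set (T2 -> T2)).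
Variables (phi : (T1 -> T1) -> T2 -> T2) (psi : (T2 -> T2) -> T1 -> T1).
Hypotheses (gr : fun_subgroup Gam1) (iso : mutual_iso Gam1 Gam2 phi psi).

Let comp f g : Gam1 f -> Gam1 g -> Gam1 (f \o g).
Proof. by case: gr => _ + _; apply. Qed.

Lemma iso_inverse_pair f f' : Gam1 f -> Gam1 f' -> inverse_pair f f' ->
  inverse_pair (phi f) (phi f').
Proof.
by move=> Gf Gf' [e1 e2]; split; rewrite -(iso_comp iso) ?(e1, e2) // (iso_id iso).
Qed.

Lemma iso_commute f g : Gam1 f -> Gam1 g -> f \o g = g \o f ->
  phi f \o phi g = phi g \o phi f.
Proof. by move=> Gf Gg e; rewrite -!(iso_comp iso) // e. Qed.

Lemma iso_involution t : Gam1 t -> t \o t = id -> phi t \o phi t = id.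
Proof. by move=> Gt e; rewrite -(iso_comp iso) // e (iso_id iso). Qed.

End AlgebraTransport.

(** The quantifiers of [inv_part] range over the group alone: the test elements are pulled back by
    [psi] and the resulting relation is pushed forward by [phi]. The next two lemmas follow the same
    pattern. *)
Lemma inv_part_transport {T1 T2 : Type} (Gam1 : set (T1 -> T1))
    (Gam2 : set (T2 -> T2)) phi psi t s :
  fun_subgroup Gam1 -> mutual_iso Gam1 Gam2 phi psi ->
  Gam1 t -> inv_part Gam1 t s -> inv_part Gam2 (phi t) (phi s).
Proof.
move=> [_ c1 _] iso Gt [[Gs ss cj] st]; split; last exact: (iso_commute iso).
have osi := mutual_iso_sym iso.
split; [exact: (iso_fwd iso) | exact: (iso_involution iso) | move=> a a' Ga Ga' ia at_].
have [Gb Gb'] := (iso_bwd iso Ga, iso_bwd iso Ga').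
rewrite -(iso_bwdK iso Ga) -(iso_bwdK iso Ga').
have Gb1 := c1 _ _ Gb Gs; have Gb2 := c1 _ _ Gb1 Gb'.
rewrite -(iso_comp iso Gb Gs) -(iso_comp iso Gb1 Gb') -(iso_comp iso Gs Gb2).
rewrite -(iso_comp iso Gb2 Gs).
congr phi; apply: cj => //; first exact: (iso_inverse_pair osi).
rewrite -{1}(iso_fwdK iso Gt) -{2}(iso_fwdK iso Gt).
by apply: (iso_commute osi) => //; exact: (iso_fwd iso).
Qed.

Lemma inv_cent_transport {T1 T2 : Type} (Gam1 : set (T1 -> T1))
    (Gam2 : set (T2 -> T2)) phi psi t v :
  fun_subgroup Gam2 -> mutual_iso Gam1 Gam2 phi psi ->
  Gam1 t -> inv_cent Gam1 t v -> inv_cent Gam2 (phi t) (phi v).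
Proof.
move=> gr2 iso Gt [Gv vs]; split; first exact: (iso_fwd iso).
have osi := mutual_iso_sym iso.
move=> s ips; have Gs : Gam2 s by case: ips => -[].
rewrite -(iso_bwdK iso Gs); apply: (iso_commute iso) => //; first exact: (iso_bwd iso).
apply: vs; rewrite -(iso_fwdK iso Gt); apply: (inv_part_transport gr2 osi) => //.
exact: (iso_fwd iso).
Qed.

Lemma rigid_transport {T1 T2 : Type} (Gam1 : set (T1 -> T1)) (Gam2 : set (T2 -> T2))
    phi psi t w : fun_subgroup Gam1 -> fun_subgroup Gam2 ->
  mutual_iso Gam1 Gam2 phi psi ->
  Gam1 t -> rigid Gam1 t w -> rigid Gam2 (phi t) (phi w).
Proof.
move=> gr1 gr2 iso Gt [Gw wv]; split; first exact: (iso_fwd iso).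
have osi := mutual_iso_sym iso.
move=> v icv; have Gv : Gam2 v by case: icv.
have Gv' := iso_bwd iso Gv.
have [_ c1 _] := gr1.
rewrite -(iso_bwdK iso Gv) -(iso_comp iso) //; apply: (iso_commute iso) => //.
  exact: c1.
apply: wv; rewrite -(iso_fwdK iso Gt).
by apply: (inv_cent_transport gr1 osi) => //; exact: (iso_fwd iso).
Qed.

Definition supp_sub {T : topologicalType} (w t : T -> T) :=
  closure (moved w) `<=` closure (moved t).

(** By [rigidP] on both sides, the inclusion is membership in [rigid], which [phi] preserves. *)
Lemma supp_transport {T1 T2 : topologicalType} (X1 : set T1) (X2 : set T2) Gam1 Gam2
    phi psi t w : hausdorff_space T1 -> hausdorff_space T2 ->
  locally_rich X1 Gam1 -> locally_rich X2 Gam2 -> mutual_iso Gam1 Gam2 phi psi ->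
  Gam1 t -> t \o t = id -> Gam1 w -> supp_sub w t -> supp_sub (phi w) (phi t).
Proof.
move=> h1 h2 r1 r2 iso Gt tt Gw /(subset_trans (@subset_closure _ _)) wt.
have gr1 := rich_group r1; have gr2 := rich_group r2.
have := rigid_transport gr1 gr2 iso Gt (proj2 (rigidP h1 r1 w Gt tt) (conj Gw wt)).
move=> /(rigidP h2 r2 _ (iso_fwd iso Gt) (iso_involution iso Gt tt)) [_ H].
by move=> z /(closure_subset H) cz; exact: closed_closure cz.
Qed.

Lemma closure_moved_conj {T : topologicalType} (c c' t : T -> T) z :
  continuous c' -> inverse_pair c c' ->
  closure (moved t) z -> closure (moved (c' \o t \o c)) (c' z).
Proof.
move=> cc' [e1 e2] cz B /cc' /cz [y [ty By]]; exists (c' y); split=> // e.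
have /(congr1 c) : c' (t (c (c' y))) = c' y by exact: e.
by rewrite !(compK e1).
Qed.

Section SpatialRealization.
Context {T1 T2 : topologicalType} (X1 : set T1) (X2 : set T2).
Variables (Gam1 : set (T1 -> T1)) (Gam2 : set (T2 -> T2)).
Variables (phi : (T1 -> T1) -> T2 -> T2) (psi : (T2 -> T2) -> T1 -> T1).
Hypotheses (h1 : hausdorff_space T1) (h2 : hausdorff_space T2).
Hypotheses (r1 : locally_rich X1 Gam1) (r2 : locally_rich X2 Gam2).
Hypothesis iso : mutual_iso Gam1 Gam2 phi psi.

(* The graph of the homeomorphism of the spaces that implements [phi]. *)
Definition matching x y := [/\ X1 x, X2 y & forall t, Gam1 t -> t \o t = id ->
  closure (moved t) x -> closure (moved (phi t)) y].

(** The supports of [phi t], for involutions [t] with [x] in their support, generate a proper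
    filter: an involution supported in the intersection of two open supports around [x] refines
    both. Compactness of one support gives a cluster point [y]. *)
Lemma matching_total x : X1 x -> exists y, matching x y.
Proof.
move=> Xx.
pose P t := [/\ Gam1 t, t \o t = id & closure (moved t) x].
pose F := [set A | exists2 t, P t & closure (moved (phi t)) `<=` A].
have [t0 Pt0] : exists t, P t.
  have [t [? ? tx _]] := rich_involution r1 Xx openT I.
  by exists t; split => //; exact: (@subset_closure _ (moved t)) tx.
have ne t : P t -> closure (moved (phi t)) !=set0.
  move=> [Gt tt tx].
  have [y my] : exists y, moved (phi t) y.
    apply: exists_moved => e.
    have [z []] := tx _ filterT; case.
    by have := iso_fwdK iso Gt; rewrite e (iso_id_bwd iso) => <-.
  by exists y; exact: subset_closure.
have FF : ProperFilter F.
  split; first by move=> [t /ne [y my] /(_ _ my)].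
  split; first by exists t0.
    move=> A B [t [Gt tt tx] tA] [s [Gs ss sx] sB].
    have [r [Gr rr rx rB]] := rich_involution r1 Xx
      (openI (rich_support_open r1 Gt) (rich_support_open r1 Gs)) (conj tx sx).
    exists r; first by split => //; exact: subset_closure.
    move=> y ry; split; [apply: tA | apply: sB].
    - by apply: (supp_transport h1 h2 r1 r2 iso Gt tt Gr) ry => z /rB [].
    - by apply: (supp_transport h1 h2 r1 r2 iso Gs ss Gr) ry => z /rB [].
  by move=> A B AB [t Pt tA]; exists t => //; exact: subset_trans tA AB.
have [Gt0 _ _] := Pt0.
have [|y [ty cl]] := rich_support_compact r2 (iso_fwd iso Gt0) FF; first by exists t0.
exists y; split => //; first exact: (rich_support_sub r2 (iso_fwd iso Gt0)).
move=> t Gt tt tx; apply: (@closed_closure _ (moved (phi t))) => B nB.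
by apply: cl => //; exists t.
Qed.

(** Otherwise some involution [s] moves [x] and is supported off the support of [psi t]. The
    supports of [t] and [phi s] then share [y], so a nontrivial [r] fits in both, and [psi r] would
    be supported in two disjoint sets. *)
Lemma matching_rev x y t : matching x y -> Gam2 t -> t \o t = id ->
  closure (moved t) y -> closure (moved (psi t)) x.
Proof.
move=> [Xx Xy xy] Gt tt ty; apply: contrapT => nx.
have osi := mutual_iso_sym iso.
have Gt' := iso_bwd iso Gt.
have [||s [Gs ss sx sB]] := rich_involution r1 Xx (B := ~` closure (moved (psi t))) => //.
  by apply: closed_openC; exact: closed_closure.
have sy : closure (moved (phi s)) y by apply: xy => //; exact: subset_closure.
have [r [Gr rr ry rB]] := rich_involution r2 Xy
  (openI (rich_support_open r2 Gt) (rich_support_open r2 (iso_fwd iso Gs))) (conj ty sy).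
have Gr' := iso_bwd iso Gr.
have [z mz] : exists z, moved (psi r) z.
  apply: exists_moved => e; apply: ry.
  by have := iso_bwdK iso Gr; rewrite e (iso_id iso) => <-.
have cz := subset_closure mz.
have H1 : closure (moved (psi t)) z.
  by apply: (supp_transport h2 h1 r2 r1 osi Gt tt Gr) cz => u /rB [].
have : closure (moved s) z.
  rewrite -(iso_fwdK iso Gs).
  apply: (supp_transport h2 h1 r2 r1 osi (iso_fwd iso Gs) _ Gr) cz => [|u /rB [] //].
  exact: (iso_involution iso).
by move=> /sB.
Qed.

(** An involution [t] that moves [y] and is supported away from [y'] has [x] in the support of
    [psi t], by [matching_rev]; hence [y'] would lie in the support of [t]. *)
Lemma matching_functional x y y' : matching x y -> matching x y' -> y = y'.
Proof.
move=> xy [_ _ xy']; apply: contrapT => /(separate h2) [A [B [oA oB Ay By AB]]].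
have [Xx Xy _] := xy.
have [t [Gt tt ty tA]] := rich_involution r2 Xy oA Ay.
have tx := matching_rev xy Gt tt (subset_closure ty).
have := xy' _ (iso_bwd iso Gt) (iso_involution (mutual_iso_sym iso) Gt tt) tx.
by rewrite (iso_bwdK iso Gt) => /tA /AB.
Qed.

(** If [c x] lies in the support of [t], then [x] lies in that of the conjugate of [t] by [c'], and
    [phi] respects conjugation. *)
Lemma matching_equivariant c x y : Gam1 c -> matching x y -> matching (c x) (phi c y).
Proof.
move=> Gc [Xx Xy xy].
have [c' Gc' ic] := rich_inverse r1 Gc.
have ic2 := iso_inverse_pair iso Gc Gc' ic.
have cont1 := rich_continuous r1; have cont2 := rich_continuous r2.
have stable (T : topologicalType) (X : set T) Gam f z : locally_rich X Gam ->
    Gam f -> X z -> X (f z).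
  move=> r Gf Xz; have [-> //|m] := pselect (f z = z).
  apply: (rich_moved_sub r Gf); apply: moved_inj m; exact: (rich_inj r Gf).
split; [exact: (stable _ _ _ _ _ r1) | exact: (stable _ _ _ _ _ r2 (iso_fwd iso Gc)) |].
move=> t Gt tt /(closure_moved_conj (cont1 _ Gc') ic); rewrite (compK ic.2) => tx.
have Gtc := rich_comp r1 Gt Gc.
have := xy (c' \o (t \o c)) _ _ tx => /(_ (rich_comp r1 Gc' Gtc)).
rewrite (iso_comp iso Gc' Gtc) (iso_comp iso Gt Gc) => ty.
have : closure (moved (phi c' \o (phi t \o phi c))) y.
  by apply: ty; apply/funext => z /=; rewrite (compK ic.1) (compK tt) (compK ic.2).
move=> /(closure_moved_conj (cont2 _ (iso_fwd iso Gc)) (inverse_pair_sym ic2)).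
congr (closure (moved _) _); apply/funext => z /=.
by rewrite !(compK ic2.1).
Qed.

(** The neighbourhood is the open support of [psi t], which the matching carries into the support of
    [t]. *)
Lemma matching_continuous x y B : matching x y -> open B -> B y ->
  exists A, [/\ open A, A x & forall x' y', A x' -> matching x' y' -> B y'].
Proof.
move=> xy oB By; have [Xx Xy _] := xy.
have [t [Gt tt ty tB]] := rich_involution r2 Xy oB By.
exists (closure (moved (psi t))); split.
- exact: (rich_support_open r1 (iso_bwd iso Gt)).
- exact: (matching_rev xy Gt tt (subset_closure ty)).
move=> x' y' tx [_ _] /(_ _ (iso_bwd iso Gt) (iso_involution (mutual_iso_sym iso) Gt tt) tx).
by rewrite (iso_bwdK iso Gt) => /tB.
Qed.

End SpatialRealization.

Lemma matching_sym {T1 T2 : topologicalType} (X1 : set T1) (X2 : set T2) Gam1 Gam2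
    phi psi x y : hausdorff_space T1 -> hausdorff_space T2 ->
  locally_rich X1 Gam1 -> locally_rich X2 Gam2 -> mutual_iso Gam1 Gam2 phi psi ->
  matching X1 X2 Gam1 phi x y -> matching X2 X1 Gam2 psi y x.
Proof.
move=> h1 h2 r1 r2 iso xy; have [Xx Xy _] := xy; split=> // t Gt tt.
exact: (matching_rev h1 h2 r1 r2 iso xy).
Qed.

(** * Germs in etale groupoids *)

Section GroupoidAlgebra.
Context {G : topologicalType} (X : groupoid_data G).
Hypothesis gpd : is_groupoid X.
Local Notation comp := (gcomp X).
Local Notation mul := (gmul X).
Local Notation inv := (ginv X).
Local Notation src := (gsrc X).
Local Notation rng := (grng X).
Local Notation units := (unit_space X).
Implicit Types g h k u : G.

Lemma ginvK g : inv (inv g) = g.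
Proof. by case: gpd. Qed.

Lemma gcompA g h k : comp g h -> comp h k ->
  [/\ comp (mul g h) k, comp g (mul h k) & mul (mul g h) k = mul g (mul h k)].
Proof. by case: gpd => _ + _ _; apply. Qed.

Lemma gcompVg g : comp (inv g) g.
Proof. by case: gpd. Qed.

Lemma gcompgV g : comp g (inv g).
Proof. by rewrite -{1}(ginvK g); exact: gcompVg. Qed.

Lemma gmulKg g h : comp g h -> mul (inv g) (mul g h) = h.
Proof. by case: gpd => _ _ _ H /H []. Qed.

Lemma gmulgK g h : comp g h -> mul (mul g h) (inv h) = g.
Proof. by case: gpd => _ _ _ H /H []. Qed.

Lemma gmul_src g : comp g (src g) /\ mul g (src g) = g.
Proof.
have [_ c e] := gcompA (gcompgV g) (gcompVg g).
by split=> //; rewrite -e -{3}(ginvK g) gmulgK //; exact: gcompgV.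
Qed.

Lemma gmul_rng g : comp (rng g) g /\ mul (rng g) g = g.
Proof.
have [c _ e] := gcompA (gcompgV g) (gcompVg g).
by split=> //; rewrite e (proj2 (gmul_src g)).
Qed.

(** Recovers the primitive composability relation from source and range: if [g h] is composable,
    cancelling [g] in [g (h h^-1)] identifies [h h^-1] with [g^-1 g]. *)
Lemma gcompP g h : comp g h <-> src g = rng h.
Proof.
split=> [gh|e].
  have [_ c e] := gcompA gh (gcompgV h).
  by have := gmulKg c; rewrite -e gmulgK.
have [c1 e1] := gmul_src g; have [c2 _] := gmul_rng h.
by rewrite -e in c2; have [+ _ _] := gcompA c1 c2; rewrite e1.
Qed.

Lemma gsrcV g : src (inv g) = rng g.
Proof. by rewrite /gsrc ginvK. Qed.

Lemma grngV g : rng (inv g) = src g.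
Proof. by rewrite /grng ginvK. Qed.

Lemma grng_src g : rng (src g) = src g.
Proof. by apply/esym/gcompP; case: (gmul_src g). Qed.

Lemma gsrc_rng g : src (rng g) = rng g.
Proof. by apply/gcompP; case: (gmul_rng g). Qed.

Lemma grng_rng g : rng (rng g) = rng g.
Proof. by rewrite -[in LHS](gsrcV g) grng_src gsrcV. Qed.

Lemma grngM g h : comp g h -> rng (mul g h) = rng g.
Proof.
move=> gh; have [c _] := gmul_rng g.
by have [_ /gcompP <- _] := gcompA c gh; rewrite gsrc_rng.
Qed.

Lemma gsrcM g h : comp g h -> src (mul g h) = src h.
Proof.
move=> gh; have [c _] := gmul_src h.
by have [/gcompP -> _ _] := gcompA gh c; rewrite grng_src.
Qed.

Lemma unitP u : units u <-> rng u = u.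
Proof. by split=> [[g _ <-]|<-]; [rewrite grng_rng | exists u]. Qed.

Lemma unit_rng g : units (rng g). Proof. by exists g. Qed.

Lemma unit_src g : units (src g).
Proof. by apply/unitP; rewrite grng_src. Qed.

Lemma src_unit u : units u -> src u = u.
Proof. by move=> [g _ <-]; rewrite gsrc_rng. Qed.

Lemma rng_unit u : units u -> rng u = u.
Proof. by move/unitP. Qed.

Lemma unit_divg g h : rng g = rng h -> units (mul (inv g) h) -> g = h.
Proof.
move=> e U; have c : comp (inv g) h by apply/gcompP; rewrite gsrcV.
have := gmulKg c; rewrite ginvK => <-.
rewrite -(rng_unit U) grngM // grngV.
by rewrite (proj2 (gmul_src g)).
Qed.

Lemma gmulgVK g h : src g = src h -> comp g (inv h) /\ mul (mul g (inv h)) h = g.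
Proof.
move=> e; have c : comp g (inv h) by apply/gcompP; rewrite grngV.
by split=> //; have := gmulgK c; rewrite ginvK.
Qed.

End GroupoidAlgebra.

(** The arrow [g] realizes the germ of [f] at its source. Asking this of all arrows near [g] makes
    the condition open in [g] without choosing a bisection. *)
Definition germ {G : topologicalType} (X : groupoid_data G) (f : G -> G) (g : G) :=
  nbhs g [set k | f (gsrc X k) = grng X k].

(** * Open maps and germs in a Hausdorff etale groupoid *)

Section EtaleTopology.
Context {G : topologicalType} (X : groupoid_data G).
Hypotheses (et : etale X) (hG : hausdorff_space G).
Local Notation comp := (gcomp X).
Local Notation mul := (gmul X).
Local Notation inv := (ginv X).
Local Notation src := (gsrc X).
Local Notation rng := (grng X).
Local Notation units := (unit_space X).
Implicit Types (g h k u x : G) (f t : G -> G) (A B W O : set G).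

Lemma etale_groupoid : is_groupoid X.
Proof. by case: et => -[]. Qed.

Let gpd := etale_groupoid.

Lemma inv_continuous : continuous inv.
Proof. by case: et => -[]. Qed.

Lemma mul_near g h O : comp g h -> open O -> O (mul g h) -> exists A B,
  [/\ open A, open B, A g, B h & forall a b, A a -> B b -> comp a b -> O (mul a b)].
Proof.
move=> gh oO Ogh; case: et => -[_ _ /subspace_continuousP ct] _.
have /(_ O (open_nbhs_nbhs (conj oO Ogh))) := ct (g, h) gh.
rewrite /within /= => -[[A B] /= [nA nB] AB].
have [A' [oA' gA' sA]] := open_subset_nbhs nA.
have [B' [oB' hB' sB]] := open_subset_nbhs nB.
exists A', B'; split=> // a b Aa Bb ab; apply: (AB (a, b)) => //=.
by split; [exact: sA | exact: sB].
Qed.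

Lemma rng_continuous : continuous rng.
Proof.
move=> g O /open_subset_nbhs [O' [oO Og OO]].
have [A [B [oA oB Ag Bg AB]]] := mul_near (gcompgV gpd g) oO Og.
have : nbhs g (A `&` inv @^-1` B).
  apply: filterI; first exact: open_nbhs_nbhs.
  by apply: inv_continuous; exact: open_nbhs_nbhs.
by apply: filterS => k [Ak Bk]; apply/OO/AB => //; exact: gcompgV.
Qed.

Lemma src_continuous : continuous src.
Proof.
have -> : src = rng \o inv by apply/funext => g /=; rewrite grngV.
by move=> g; apply: continuous_comp; [exact: inv_continuous | exact: rng_continuous].
Qed.

Lemma rng_locally_inj g : exists U, [/\ open U, U g &
  forall h k, U h -> U k -> rng h = rng k -> h = k].
Proof.
have [_ /(_ g) [U [oU Ug inj _ _]]] := et; exists U; split=> // h k Uh Uk.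
by apply: inj; rewrite in_setE.
Qed.

Lemma src_locally_inj g : exists U, [/\ open U, U g &
  forall h k, U h -> U k -> src h = src k -> h = k].
Proof.
have [U [oU Ug inj]] := rng_locally_inj (inv g).
exists (inv @^-1` U); split=> //; first exact: open_preimage inv_continuous oU.
move=> h k Uh Uk; rewrite -!(grngV gpd) => /(inj _ _ Uh Uk).
by move=> /(congr1 inv); rewrite !ginvK.
Qed.

(** An arrow [k] close to a unit is close to its own range [rng k]; both have the same range, so
    local injectivity identifies them. *)
Lemma open_units : open units.
Proof.
apply: open_nearP => u Uu; have [U [oU Ug inj]] := rng_locally_inj u.
exists (U `&` rng @^-1` U); split.
- by apply: openI => //; exact: open_preimage rng_continuous oU.
- by split=> //=; rewrite (rng_unit gpd).
move=> k [Uk Urk]; apply/unitP => //; apply: inj => //; exact: grng_rng.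
Qed.

Lemma closed_units : closed units.
Proof.
have -> : units = ~` moved rng.
  apply/seteqP; split => u; first by move=> /(rng_unit gpd) e; apply.
  by move=> /contrapT /(unitP gpd).
by apply: open_closedC; apply: open_moved => //; exact: rng_continuous.
Qed.

Lemma rng_open W : open W -> open (rng @` W).
Proof.
move=> oW; apply: open_nearP => x [g Wg <-].
have [_ /(_ g) [U [oU Ug _ _ im]]] := et.
have [|V [oV e]] := im (U `&` W) (openI oU oW); first by move=> ? [].
exists (rng @` (U `&` W)); split.
- by rewrite e; apply: openI => //; exact: open_units.
- by exists g.
- by move=> _ [k [_ Wk] <-]; exists k.
Qed.

Lemma inv_open W : open W -> open (inv @` W).
Proof.
move=> oW; have -> : inv @` W = inv @^-1` W.
  apply/seteqP; split => [_ [g Wg <-] /=|g Wg]; first by rewrite ginvK.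
  by exists (inv g) => //; rewrite ginvK.
exact: open_preimage inv_continuous oW.
Qed.

Lemma src_open W : open W -> open (src @` W).
Proof.
move=> oW; have -> : src @` W = rng @` (inv @` W).
  apply/seteqP; split => [_ [g Wg <-]|_ [_ [g Wg <-] <-]].
    by exists (inv g); [exists g | rewrite grngV].
  by exists g => //; rewrite grngV.
by apply: rng_open; exact: inv_open.
Qed.

(** An arrow [k] near [a b] factors as [a' (a'^-1 k)], where [a'] near [a] has the range of [k];
    such [a'] exists because the range map is open. *)
Lemma mul_open A B : open A -> open B ->
  open [set k | exists a b, [/\ A a, B b, comp a b & k = mul a b]].
Proof.
move=> oA oB; apply: open_nearP => _ [a [b [Aa Bb ab ->]]].
have c : comp (inv a) (mul a b) by apply/gcompP => //; rewrite gsrcV // grngM.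
have := mul_near c oB; rewrite gmulKg // => /(_ Bb) [N1 [N2 [o1 o2 N1a N2b N12]]].
set A' := A `&` inv @^-1` N1.
have oA' : open A' by apply: openI => //; exact: open_preimage inv_continuous o1.
exists (N2 `&` rng @^-1` (rng @` A')); split.
- by apply: openI => //; apply: open_preimage rng_continuous _; exact: rng_open.
- by split=> //; exists a; rewrite // grngM.
move=> k [N2k [a' [Aa' N1a'] e]].
have c' : comp (inv a') k by apply/gcompP => //; rewrite gsrcV.
exists a', (mul (inv a') k); split=> //; first exact: N12.
  by apply/gcompP => //; rewrite grngM // grngV.
by have := gmulKg gpd c'; rewrite ginvK.
Qed.

Lemma germ_open f g : germ X f g -> exists W,
  [/\ open W, W g, (forall k, W k -> f (src k) = rng k) & forall k, W k -> germ X f k].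
Proof.
move=> /open_subset_nbhs [W [oW Wg H]]; exists W; split=> // k Wk.
by rewrite /germ nbhsE; exists W.
Qed.

Lemma germ_at f g : germ X f g -> f (src g) = rng g.
Proof. by move=> /germ_open [W [_ Wg H _]]; exact: H. Qed.

Lemma open_germ f W g : open W -> W g -> (forall k, W k -> f (src k) = rng k) -> germ X f g.
Proof. by move=> oW Wg H; rewrite /germ nbhsE; exists W. Qed.

Lemma germ_mul f f' g g' : germ X f g -> germ X f' g' -> comp g' g ->
  germ X (f' \o f) (mul g' g).
Proof.
move=> /germ_open [W [oW Wg H _]] /germ_open [W' [oW' Wg' H' _]] c.
apply: (open_germ (mul_open oW' oW)); first by exists g', g.
move=> _ [a [b [Wa Wb ab ->]]] /=.
rewrite gsrcM // grngM // (H b Wb) -(H' a Wa); congr f'.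
by apply/esym/gcompP.
Qed.

Lemma germ_inv f f' g : inverse_pair f f' -> germ X f g -> germ X f' (inv g).
Proof.
move=> [_ e] /germ_open [W [oW Wg H _]].
apply: (@open_germ _ (inv @` W)); [exact: inv_open | by exists g |].
move=> _ [k Wk <-]; rewrite gsrcV // grngV // -H //; exact: (compK e).
Qed.

Lemma germ_local f f' g O : open O -> O (src g) -> (forall x, O x -> f x = f' x) ->
  germ X f g -> germ X f' g.
Proof.
move=> oO Og ff' /germ_open [W [oW Wg H _]].
apply: (@open_germ _ (W `&` src @^-1` O)) => //.
  by apply: openI => //; exact: open_preimage src_continuous oO.
by move=> k [Wk Ok]; rewrite -ff' // H.
Qed.

Lemma germ_fixed f u O : units u -> open O -> O u ->
  (forall x, O x -> units x -> f x = x) -> germ X f u.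
Proof.
move=> Uu oO Ou H; apply: (@open_germ _ (O `&` units)) => //.
  by apply: openI => //; exact: open_units.
by move=> k [Ok Uk]; rewrite src_unit // rng_unit // H.
Qed.

Lemma germ_agree f1 f2 g : germ X f1 g -> germ X f2 g ->
  exists O, [/\ open O, O (src g) & forall x, O x -> f1 x = f2 x].
Proof.
move=> /germ_open [W1 [o1 W1g H1 _]] /germ_open [W2 [o2 W2g H2 _]].
exists (src @` (W1 `&` W2)); split; first by apply/src_open/openI.
  by exists g.
by move=> _ [k [W1k W2k] <-]; rewrite H1 // H2.
Qed.

(** The products of inverses of arrows near [g2] with arrows near [g1] form an open set of isotropy
    arrows. By effectiveness [g2^-1 g1] is a unit. *)
Lemma germ_unique f1 f2 g1 g2 O : effective X -> injective f2 ->
  germ X f1 g1 -> germ X f2 g2 -> src g1 = src g2 ->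
  open O -> O (src g1) -> (forall x, O x -> f1 x = f2 x) -> g1 = g2.
Proof.
move=> eff inj G1 G2 e oO Og ff.
have [W1 [o1 W1g H1 _]] := germ_open (germ_local oO Og ff G1).
have [W2 [o2 W2g H2 _]] := germ_open G2.
have rr : rng g2 = rng g1 by rewrite -(H1 g1 W1g) -(H2 g2 W2g) e.
apply/esym/(unit_divg gpd) => //; rewrite -eff.
pose K := [set k | exists a b, [/\ (inv @` W2) a, W1 b, comp a b & k = mul a b]].
have oK : open K by apply: mul_open => //; exact: inv_open.
rewrite /interior nbhsE; exists K.
  split=> //; exists (inv g2), g1; split=> //.
  by apply/gcompP => //; rewrite gsrcV.
move=> _ [_ [b [[a Wa <-] Wb ab ->]]].
rewrite /isotropy /= gsrcM // grngM // grngV //; apply: inj.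
rewrite (H1 b Wb) (H2 a Wa); apply/esym; rewrite -gsrcV //; exact/gcompP.
Qed.

End EtaleTopology.

(** * The topological full group and its commutator subgroup *)

Section FullGroup.
Context {G : topologicalType} (X : groupoid_data G).
Hypothesis good : good_groupoid X.
Local Notation comp := (gcomp X).
Local Notation mul := (gmul X).
Local Notation inv := (ginv X).
Local Notation src := (gsrc X).
Local Notation rng := (grng X).
Local Notation units := (unit_space X).
Implicit Types (g h k u x : G) (f t : G -> G) (A B W O : set G).

Let eff : effective X. Proof. by case: good. Qed.
Let et : etale X. Proof. by case: good => _ []. Qed.
Let hG : hausdorff_space G. Proof. by case: good. Qed.
Let gpd := etale_groupoid et.

(** A description by germs, without reference to a bisection; the later constructions of elements
    verify this form. *)
Lemma full_groupP f : full_group X f <->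
  [/\ exists f', inverse_pair f f', moved f `<=` units,
      exists2 K, compact K & moved f `<=` K &
      forall x, units x -> exists2 g, src g = x & germ X f g].
Proof.
split.
- move=> [U [[[oU sinj rinj] sU rU] [fU fid] cf]].
  have fs g : U g -> f (src g) = rng g.
    move=> Ug; have [k [Uk e ->]] := fU _ (unit_src gpd g).
    by congr rng; apply: sinj; rewrite ?in_setE.
  have fstable x : units (f x) -> units x.
    by move=> Ufx; apply: contrapT => n; apply: (n); rewrite -(fid _ n).
  have finj : injective f.
    move=> x y e; have [Ux|nx] := pselect (units x); last first.
      have ny : ~ units y.
        by move=> /fU [g [_ _ ey]]; apply: nx; apply: fstable; rewrite e ey; exact: unit_rng.
      by rewrite -(fid _ nx) e fid.
    have [g [Ug eg eg']] := fU _ Ux.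
    have Uy : units y by apply: fstable; rewrite -e eg'; exact: unit_rng.
    have [k [Uk ek ek']] := fU _ Uy.
    by rewrite -eg -ek; congr src; apply: rinj; rewrite ?in_setE // -eg' -ek'.
  have /choice [f' f'P] : forall y, exists x, f x = y.
    move=> y; have [|ny] := pselect (units y); last by exists y; exact: fid.
    by rewrite -rU => -[g Ug <-]; exists (src g); exact: fs.
  have mf : moved f `<=` units.
    by move=> x m; apply: contrapT => /fid.
  split=> //.
  + exists f'; split; apply/funext => x /=; first exact: f'P.
    by apply: finj; rewrite f'P.
  + exists (Defs.support X f) => // x m; have Ux := mf _ m; split=> //.
    exact: (@subset_closure _ [set x | units x /\ f x <> x]).
  + move=> x /fU [g [Ug <- _]]; exists g => //.
    exact: open_germ oU Ug fs.
- move=> [[f' ff'] mf [K cK fK] gf].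
  have finj := inverse_pair_inj ff'.
  (* The bisection is recovered as the set of all arrows realizing germs of [f]; [germ_unique] makes
     source and range injective on it. *)
  pose U := [set g | germ X f g].
  exists U; split.
  + split; first split.
    * apply: open_nearP => g /germ_open [W [oW Wg _ H]]; by exists W.
    * move=> g k; rewrite !in_setE => Ug Uk e.
      exact: (germ_unique et eff finj Ug Uk e openT).
    * move=> g k; rewrite !in_setE => Ug Uk; rewrite -(germ_at Ug) -(germ_at Uk) => /finj e.
      exact: (germ_unique et eff finj Ug Uk e openT).
    * apply/seteqP; split => [_ [g _ <-]|x /gf [g <- Ug]]; first exact: unit_src.
      by exists g.
    * apply/seteqP; split => [_ [g _ <-]|y Uy]; first exact: unit_rng.
      have [|g e Ug] := gf (f' y).
        apply: contrapT => n; apply: (n).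
        by rewrite -(notin_moved (fun m => n (mf _ m))) (compK ff'.1).
      by exists g => //; rewrite -(germ_at Ug) e (compK ff'.1).
  + split; last by move=> x n; apply: notin_moved => /mf.
    by move=> x /gf [g <- Ug]; exists g; rewrite (germ_at Ug).
  + apply: (@subclosed_compact _ _ K) => //.
      by apply: closedI; [exact: closed_closure | exact: closed_units].
    move=> x [+ _]; have /closure_id -> := compact_closed hG cK.
    by apply: closure_subset; apply: subset_trans fK => y [].
Qed.

Lemma full_inverse f : full_group X f -> exists f', inverse_pair f f'.
Proof. by move=> /full_groupP []. Qed.

Lemma full_inj f : full_group X f -> injective f.
Proof. by move=> /full_inverse [f']; exact: inverse_pair_inj. Qed.

Lemma full_moved f : full_group X f -> moved f `<=` units.
Proof. by move=> /full_groupP []. Qed.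

Lemma full_germ f x : full_group X f -> units x -> exists2 g, src g = x & germ X f g.
Proof. by move=> /full_groupP [_ _ _ +]; apply. Qed.

Lemma full_continuous f : full_group X f -> continuous f.
Proof.
move=> Ff x; have [Ux|nx] := pselect (units x).
  have [g <- gf] := full_germ Ff Ux.
  have [W [oW Wg H _]] := germ_open gf.
  move=> O; rewrite (H _ Wg) => /open_subset_nbhs [O' [oO Og OO]].
  change (nbhs (src g) (f @^-1` O)).
  apply: (@filterS _ _ _ (src @` (W `&` rng @^-1` O'))).
    by move=> _ [k [Wk Ok] <-]; rewrite /= H //; exact: OO.
  apply: open_nbhs_nbhs; split; last by exists g.
  by apply: src_open => //; apply: openI => //; exact: open_preimage (rng_continuous et) oO.
have fid y : ~ units y -> f y = y.
  by move=> ny; apply: notin_moved => /(full_moved Ff).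
move=> O; rewrite fid // => nO; change (nbhs x (f @^-1` O)).
apply: (@filterS _ _ _ (O `&` ~` units)); first by move=> y [Oy /fid e]; rewrite /= e.
apply: filterI => //; apply: open_nbhs_nbhs; split => //.
by apply: closed_openC; exact: closed_units.
Qed.

Lemma full_id : full_group X id.
Proof.
apply/full_groupP; split.
- by exists id.
- by move=> x /(_ erefl).
- by exists set0; [exact: compact0 | move=> x /(_ erefl)].
- by move=> x Ux; exists x; [exact: src_unit | apply: (germ_fixed et Ux openT)].
Qed.

Lemma full_comp f f' : full_group X f -> full_group X f' -> full_group X (f' \o f).
Proof.
move=> /full_groupP [[h ih] m [K cK fK] H] /full_groupP [[h' ih'] m' [K' cK' fK'] H'].
have sub : moved (f' \o f) `<=` moved f `|` moved f'.
  move=> x n; apply: contrapT => /not_orP [e e'].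
  by apply: n; rewrite /= (notin_moved e) (notin_moved e').
apply/full_groupP; split.
- by exists (h \o h'); exact: inverse_pair_comp.
- by move=> x /sub [/m|/m'].
- exists (K `|` K'); first exact: compactU.
  by move=> x /sub [/fK|/fK']; [left | right].
move=> x /H [g <- Hg]; have [g' e Hg'] := H' _ (unit_rng X g).
have c : comp g' g by apply/gcompP.
by exists (mul g' g); [rewrite gsrcM | exact: germ_mul].
Qed.

Lemma full_of_inverse f f' : full_group X f -> inverse_pair f f' -> full_group X f'.
Proof.
move=> /full_groupP [_ m [K cK fK] H] ff'.
apply/full_groupP; rewrite -(moved_inverse ff') in m fK *.
split=> //; [by exists f; exact: inverse_pair_sym | by exists K |].
move=> x Ux; have [|g e Hg] := H (f' x).
  apply: contrapT => n; apply: (n).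
  suff <- : x = f' x by [].
  rewrite -{1}(compK ff'.1 x); apply: notin_moved.
  by rewrite -(moved_inverse ff') => /m.
exists (inv g); last exact: germ_inv ff' Hg.
by rewrite gsrcV // -(germ_at Hg) e (compK ff'.1).
Qed.

Lemma full_subgroup : fun_subgroup (full_group X).
Proof.
split; first exact: full_id.
  by move=> f g Ff Fg; exact: full_comp.
move=> f Ff; have [f' ff'] := full_inverse Ff.
by exists f'; case: (ff'); split=> //; exact: full_of_inverse ff'.
Qed.

Lemma derived_full : derived_set X `<=` full_group X.
Proof.
move=> f; elim=> {f} [|a b a' b' Fa Fb e1 e2 e3 e4|f g _ Ff _ Fg|f f' _ Ff e1 e2].
- exact: full_id.
- have Fa' := full_of_inverse Fa (conj e2 e1).
  have Fb' := full_of_inverse Fb (conj e4 e3).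
  exact: (full_comp Fb (full_comp Fa (full_comp Fb' Fa'))).
- exact: full_comp.
- exact: full_of_inverse Ff (conj e2 e1).
Qed.

Lemma derived_subgroup : fun_subgroup (derived_set X).
Proof.
split; [exact: dfg_id | exact: dfg_mul |].
move=> f Df; have [f' [e1 e2]] := full_inverse (derived_full Df).
by exists f'; split=> //; exact: dfg_inv e2 e1.
Qed.

(** The support is the source image of the open set of non-unit arrows realizing germs of [f], and
    the source map is open. *)
Lemma closure_moved_full f : full_group X f ->
  [/\ open (closure (moved f)), compact (closure (moved f)) & closure (moved f) `<=` units].
Proof.
move=> Ff; have mu : closure (moved f) `<=` units.
  have /closure_id -> := closed_units et hG.
  exact: closure_subset (full_moved Ff).
split=> //; last first.
  have /full_groupP [_ _ [K cK fK] _] := Ff.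
  apply: (subclosed_compact _ cK); first exact: closed_closure.
  have /closure_id -> := compact_closed hG cK.
  exact: closure_subset.
(* By effectiveness the fixed points accumulating at [src g] cannot fill a
   neighbourhood of it unless [g] is a unit. *)
have -> : closure (moved f) = src @` [set g | germ X f g /\ ~ units g].
  apply/seteqP; split => [x cx|_ [g [Hg nu] <-] B nB].
    have [g e Hg] := full_germ Ff (mu _ cx); exists g => //; split=> // Ug.
    have [W [oW Wg H _]] := germ_open Hg.
    have [|y my [k [Wk Uk] ek]] :=
      closure_open_meets cx (src_open et (openI oW (open_units et))).
      by exists g.
    by apply: my; rewrite -ek (H _ Wk) rng_unit // src_unit.
  have [W [oW Wg H _]] := germ_open Hg.
  have [B' [oB Bg BB]] := open_subset_nbhs nB.
  have : ~ interior (isotropy X) g by rewrite eff.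
  apply: contra_notP => ne.
  rewrite /interior nbhsE; exists (W `&` src @^-1` B').
    split=> //; apply: openI => //; exact: open_preimage (src_continuous et) oB.
  move=> k [Wk Bk]; apply: contrapT => nk; apply: ne; exists (src k).
  by split; [rewrite /moved /= H // => e; apply: nk; exact: esym | exact: BB].
apply: src_open => //; apply: openI.
  by apply: open_nearP => g /germ_open [W [oW Wg _ H]]; exists W.
by apply: closed_openC; exact: closed_units.
Qed.

Lemma compact_open_unit x B : units x -> open B -> B x -> exists K,
  [/\ compact K, open K, closed K, K x & K `<=` B `&` units].
Proof.
move=> Ux oB Bx; have [_ [_ _ /(_ x B Ux oB Bx) [K [cK [V [oV e]] Kx KB]]] _ _ _] := good.
exists K; split=> //; last exact: compact_closed.
by rewrite e; apply: openI => //; exact: open_units.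
Qed.

(** Minimality gives an orbit point in any open set that meets the unit space. The points of [s] are
    removed from [B] one at a time; as no unit is isolated, a unit always remains. *)
Lemma orbit_avoid x y B (s : seq G) : units x -> units y -> open B -> B y ->
  exists g, [/\ src g = x, B (rng g) & forall p, p \in s -> rng g <> p].
Proof.
move=> Ux; elim: s y B => [|p s IH] y B Uy oB By.
  have [_ _ /(_ x Ux y Uy) cl _ _] := good.
  have [_ [g /= e <-] Bg] := closure_open_meets cl oB By.
  by exists g.
have oBp : open (B `&` ~` [set p]).
  apply: openI => //; apply: closed_openC.
  by apply: accessible_closed_set1; exact: hausdorff_accessible.
have [z [Uz [Bz zp]]] : exists z, units z /\ (B `&` ~` [set p]) z.
  have [e|?] := pselect (y = p); last by exists y.
  have [_ _ _ _ /(_ y Uy B oB By) [z [Bz Uz zy]]] := good.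
  by exists z; rewrite -e.
have [g [e [Bg gp] gs]] := IH z _ Uz oBp (conj Bz zp).
exists g; split=> // q; rewrite inE => /predU1P [-> //|]; exact: gs.
Qed.

(** Around [g] there is a bisection [N] with compact open source and with disjoint source and range.
    The involution exchanges these along [N] and its inverse and is the identity elsewhere. *)
Lemma swap_exists g B1 B2 : src g <> rng g -> open B1 -> open B2 ->
  B1 (src g) -> B2 (rng g) ->
  exists a, [/\ full_group X a, a \o a = id, germ X a g & moved a `<=` B1 `|` B2].
Proof.
move=> /(separate hG) [A1 [A2 [oA1 oA2 A1g A2g A12]]] oB1 oB2 B1g B2g.
have [V1 [oV1 V1g inj1]] := src_locally_inj et g.
have [V2 [oV2 V2g inj2]] := rng_locally_inj et g.
pose N0 := (V1 `&` V2) `&` src @^-1` (B1 `&` A1) `&` rng @^-1` (B2 `&` A2).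
have oN0 : open N0.
  apply: openI; first apply: openI; first exact: openI.
    by apply: open_preimage (src_continuous et) _; exact: openI.
  by apply: open_preimage (rng_continuous et) _; exact: openI.
have N0g : N0 g by [].
have [|K [cK oK clK Kg KN]] := compact_open_unit (unit_src gpd g) (src_open et oN0).
  by exists g.
pose N := N0 `&` src @^-1` K.
have oN : open N by apply: openI => //; exact: open_preimage (src_continuous et) oK.
have sN : src @` N = K.
  apply/seteqP; split => [_ [k [_ Kk] <-] //|x Kx].
  by have [[k Nk e] _] := KN _ Kx; exists k => //; split=> //; rewrite /= e.
have sinj h k : N h -> N k -> src h = src k -> h = k.
  by move=> [[[[? _] _] _] _] [[[[? _] _] _] _]; exact: inj1.
have rinj h k : N h -> N k -> rng h = rng k -> h = k.
  by move=> [[[[_ ?] _] _] _] [[[[_ ?] _] _] _]; exact: inj2.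
(* The source map has a continuous section [t] over the compact set [K], with arbitrary values
   outside [K]. *)
have cR : compact (rng @` N).
  have /choice [t tP] : forall x, exists k, K x -> N k /\ src k = x.
    move=> x; have [|n] := pselect (K x); last by exists x.
    by rewrite -sN => -[k Nk e]; exists k.
  have tK k : N k -> t (src k) = k.
    by move=> Nk; have [|Nt e] := tP (src k); [case: Nk | exact: sinj].
  have -> : rng @` N = (rng \o t) @` K.
    rewrite -sN; apply/seteqP; split => [_ [k Nk <-]|_ [_ [k Nk <-] <-]].
      by exists (src k); [exists k | rewrite /= tK].
    by exists k => //=; rewrite tK.
  apply: continuous_compact => //; apply/subspace_continuousP => x Kx.
  have ct : t y @[y --> within K (nbhs x)] --> t x.
    move=> O /open_subset_nbhs [O' [oO Ox OO]].
    have [Nx e] := tP _ Kx.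
    change (nbhs x [set y | K y -> O (t y)]).
    apply: (@filterS _ _ _ (src @` (N `&` O'))).
      by move=> _ [k [Nk Ok] <-] _; rewrite /= tK //; exact: OO.
    apply: open_nbhs_nbhs; split; last by exists (t x).
    by apply: src_open => //; exact: openI.
  exact: cvg_comp ct (@rng_continuous _ _ et (t x)).
have clR := compact_closed hG cR.
pose M := N `|` inv @^-1` N.
have oM : open M by apply: openU => //; exact: open_preimage (inv_continuous et) oN.
have MV k : M k -> M (inv k) by rewrite /M /= (ginvK gpd) => -[]; [right | left].
(* Arrows of [N] start in [A1] and those of the inverse of [N] start in [A2], so sources never
   collide. *)
have Minj h k : M h -> M k -> src h = src k -> h = k.
  have W h' k' : N h' -> N (inv k') -> src h' <> src k'.
    move=> [[[_ [_ h1]] _] _] [[_ [_ h2]] _] e; apply: (A12 _ h1).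
    by move: h2; rewrite grngV // e.
  move=> [Nh|Nh] [Nk|Nk] e; first exact: sinj.
  - by case: (W _ _ Nh Nk).
  - by case: (W _ _ Nk Nh).
  - by rewrite -(ginvK gpd h) -(ginvK gpd k); congr inv; apply: rinj; rewrite ?grngV.
have sM : src @` M = K `|` rng @` N.
  rewrite -sN; apply/seteqP; split => [_ [k [Nk|Nk] <-]|_ [[k Nk <-]|[k Nk <-]]].
  - by left; exists k.
  - by right; exists (inv k) => //; rewrite grngV.
  - by exists k => //; left.
  - by exists (inv k); [right; rewrite /= ginvK | rewrite gsrcV].
have /choice [a aP] : forall x, exists y,
    (forall k, M k -> src k = x -> y = rng k) /\ (~ (src @` M) x -> y = x).
  move=> x; have [[k Mk e]|n] := pselect ((src @` M) x).
    exists (rng k); split=> [h Mh e'|[]]; last by exists k.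
    by congr rng; apply: Minj => //; rewrite e e'.
  by exists x; split=> // k Mk e; case: n; exists k.
have as_ k : M k -> a (src k) = rng k by move=> Mk; apply: (aP _).1.
have aid x : ~ (src @` M) x -> a x = x by apply: (aP _).2.
have aM k : M k -> germ X a k by move=> Mk; exact: open_germ oM Mk as_.
have ma : moved a `<=` src @` M by move=> x; apply: contra_notP => /aid.
have aa : a \o a = id.
  apply/funext => x /=; have [[k Mk <-]|n] := pselect ((src @` M) x).
    by rewrite as_ // -(gsrcV gpd) as_ ?grngV //; exact: MV.
  by rewrite !aid.
have Mg : M g by left.
exists a; split; [|by []|exact: aM|]; last first.
  move=> x /ma; rewrite sM -sN => -[[k [[[_ [? _]] _] _] <-]|[k [[_ [? _]] _] <-]].
    by left.
  by right.
apply/full_groupP; split.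
- by exists a; exact: involution_pair.
- by move=> x /ma [k _ <-]; exact: unit_src.
- by exists (src @` M); rewrite // sM; exact: compactU.
- move=> x Ux; have [[k Mk <-]|n] := pselect ((src @` M) x).
    by exists k => //; exact: aM.
  exists x; first exact: src_unit.
  apply: (germ_fixed et Ux (O := ~` (src @` M))) => //; last by move=> y /aid.
  by apply: closed_openC; rewrite sM; exact: closedU.
Qed.

End FullGroup.

(** * Three-cycles, involutions and local pieces in the commutator subgroup *)

Section DerivedElements.
Context {G : topologicalType} (X : groupoid_data G).
Hypothesis good : good_groupoid X.
Local Notation comp := (gcomp X).
Local Notation mul := (gmul X).
Local Notation inv := (ginv X).
Local Notation src := (gsrc X).
Local Notation rng := (grng X).
Local Notation units := (unit_space X).
Implicit Types (g h k u x : G) (f t : G -> G) (A B W O : set G).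

Let et : etale X. Proof. by case: good => _ []. Qed.
Let hG : hausdorff_space G. Proof. by case: good. Qed.
Let gpd := etale_groupoid et.

Lemma commutator_derived a b : full_group X a -> full_group X b ->
  a \o a = id -> b \o b = id -> derived_set X (a \o b \o a \o b).
Proof. by move=> Fa Fb aa bb; exact: dfg_comm. Qed.

(* [a] and [b] swap [x = src g] with [y = rng g] and with a third point [z] along
   the germs of [g] and [v]; the commutator sends [x] to [y] and [y] to [z]. *)
Lemma three_cycle g B : src g <> rng g -> open B -> B (src g) -> B (rng g) ->
  exists f, [/\ derived_set X f, germ X f g, f \o f <> id & moved f `<=` B].
Proof.
move=> sr oB Bs Br.
have [v [sv Bv vn]] := orbit_avoid good [:: src g; rng g] (unit_src gpd g) (unit_src gpd g) oB Bs.
have vs : rng v <> src g by apply: vn; rewrite inE eqxx.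
have vr : rng v <> rng g by apply: vn; rewrite !inE eqxx orbT.
have [A1 [A2 [oA1 oA2 A1s A2r A12]]] := separate hG sr.
have [A1' [A3 [oA1' oA3 A1s' A3v A13]]] := separate hG (nesym vs).
have [A2' [A3' [oA2' oA3' A2r' A3v' A23]]] := separate hG (nesym vr).
pose O1 := B `&` (A1 `&` A1'); pose O2 := B `&` (A2 `&` A2'); pose O3 := B `&` (A3 `&` A3').
have oO1 : open O1 by apply: openI => //; exact: openI.
have oO2 : open O2 by apply: openI => //; exact: openI.
have oO3 : open O3 by apply: openI => //; exact: openI.
have [a [Fa aa ag ma]] := swap_exists good sr oO1 oO2
  (conj Bs (conj A1s A1s')) (conj Br (conj A2r A2r')).
have svr : src v <> rng v by rewrite sv; exact: nesym.
have O1v : O1 (src v) by rewrite sv.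
have [b [Fb bb bv mb]] := swap_exists good svr oO1 oO3 O1v (conj Bv (conj A3v A3v')).
have a3 x : O3 x -> a x = x.
  move=> [_ [h3 h3']]; apply: notin_moved => /ma [[_ [_ h1]]|[_ [_ h2]]].
    exact: A13 h1 h3.
  exact: A23 h2 h3'.
have b2 x : O2 x -> b x = x.
  move=> [_ [h2 h2']]; apply: notin_moved => /mb [[_ [h1 _]]|[_ [_ h3]]].
    exact: A12 h1 h2.
  exact: A23 h2' h3.
have O3v : O3 (rng v) by [].
have as_ := germ_at ag; have bs := germ_at bv.
exists (a \o b \o a \o b); split.
- exact: commutator_derived.
(* Near [src g] the commutator follows [v], the unit [rng v], the inverse of [v], and finally [g];
   the product of these arrows is [g]. *)
- have cv : comp (rng v) v /\ mul (rng v) v = v by exact: gmul_rng.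
  have av : germ X (a \o b) v.
    rewrite -(proj2 cv); apply: germ_mul => //; last by case: cv.
    by apply: (germ_fixed et (unit_rng X v) oO3) => // x /a3.
  have bav : germ X (b \o (a \o b)) (mul (inv v) v).
    by apply: germ_mul => //; [exact: (germ_inv et (involution_pair bb)) | exact: gcompVg].
  have [c <-] : comp g (mul (inv v) v) /\ mul g (mul (inv v) v) = g.
    by rewrite -[mul (inv v) v]/(src v) sv; exact: gmul_src.
  exact: (germ_mul et bav ag c).
- have b_s : b (src g) = rng v by rewrite -bs sv.
  have b_v : b (rng v) = src g by rewrite -b_s (compK bb).
  have a_r : a (rng g) = src g by rewrite -as_ (compK aa).
  move=> /(congr1 (@^~ (src g))) /=.
  by rewrite b_s (a3 _ O3v) b_v as_ (b2 (rng g)) // a_r b_s (a3 _ O3v).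
- move=> x; apply: contra_notP => nB; apply: (commutator_fixed (x := x) aa bb); apply: notin_moved.
  + by move=> /ma [[]|[]].
  + by move=> /mb [[]|[]].
Qed.

(** An arrow with distinct source and range is covered by a three-cycle. An isotropy arrow is
    factored as [(g h^-1) h], where [h] leaves [src g], into two arrows of the first kind. *)
Lemma derived_germ g : exists2 f, derived_set X f & germ X f g.
Proof.
have [e|n] := pselect (src g = rng g); last first.
  by have [f [Df fg _ _]] := three_cycle n openT I I; exists f.
have [h [sh _ hn]] := orbit_avoid good [:: src g] (unit_src gpd g) (unit_src gpd g) openT I.
have hs : rng h <> src g by apply: hn; rewrite inE eqxx.
have [c ch] := gmulgVK gpd (esym sh).
have [|f1 [D1 G1 _ _]] := @three_cycle h setT _ openT I I.
  by rewrite sh; exact: nesym.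
have [|f2 [D2 G2 _ _]] := @three_cycle (mul g (inv h)) setT _ openT I I.
  by rewrite gsrcM // gsrcV // grngM // -e.
exists (f2 \o f1); first exact: dfg_mul.
rewrite -ch; apply: germ_mul => //.
by apply/gcompP => //; rewrite gsrcM // gsrcV.
Qed.

(* Double transposition in four points of the orbit of [x]: [a] exchanges [x] and
   [rng g], and [b] conjugates it to an exchange of [rng v] and [rng u]. *)
Lemma involution_exists x B : units x -> open B -> B x ->
  exists f, [/\ derived_set X f, f \o f = id, f x <> x & closure (moved f) `<=` B].
Proof.
move=> Ux oB Bx.
have [K [_ oK clK Kx KB]] := compact_open_unit good Ux oB Bx.
have [g [sg Kg gn]] := orbit_avoid good [:: x] Ux Ux oK Kx.
have gx : rng g <> x by apply: gn; rewrite inE.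
have [v [sv Kv vn]] := orbit_avoid good [:: x; rng g] Ux Ux oK Kx.
have vx : rng v <> x by apply: vn; rewrite !inE eqxx.
have vg : rng v <> rng g by apply: vn; rewrite !inE eqxx orbT.
have [u [su Ku un]] := orbit_avoid good [:: x; rng g; rng v] (unit_rng X g) Ux oK Kx.
have ux : rng u <> x by apply: un; rewrite !inE eqxx.
have ug : rng u <> rng g by apply: un; rewrite !inE eqxx !orbT.
have uv : rng u <> rng v by apply: un; rewrite !inE eqxx !orbT.
have [A1 [A2 [oA1 oA2 A1x A2g A12]]] := separate hG (nesym gx).
have [B1 [B3 [oB1 oB3 B1x B3v B13]]] := separate hG (nesym vx).
have [C1 [C4 [oC1 oC4 C1x C4u C14]]] := separate hG (nesym ux).
have [D2 [D3 [oD2 oD3 D2g D3v D23]]] := separate hG (nesym vg).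
have [E2 [E4 [oE2 oE4 E2g E4u E24]]] := separate hG (nesym ug).
have [F3 [F4 [oF3 oF4 F3v F4u F34]]] := separate hG (nesym uv).
have open4 (P Q R S : set G) : open P -> open Q -> open R -> open S ->
    open (P `&` (Q `&` (R `&` S))).
  by move=> *; do !apply: openI.
(* Pairwise disjoint neighbourhoods, inside [K], of the four points [x], [rng g], [rng v] and
   [rng u]. *)
pose O1 := K `&` (A1 `&` (B1 `&` C1)); pose O2 := K `&` (A2 `&` (D2 `&` E2)).
pose O3 := K `&` (B3 `&` (D3 `&` F3)); pose O4 := K `&` (C4 `&` (E4 `&` F4)).
have oO1 : open O1 by exact: open4.
have oO2 : open O2 by exact: open4.
have oO3 : open O3 by exact: open4.
have oO4 : open O4 by exact: open4.
have d12 z : O1 z -> ~ O2 z by move=> [_ [h _]] [_ [h' _]]; exact: A12 h h'.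
have d13 z : O1 z -> ~ O3 z by move=> [_ [_ [h _]]] [_ [h' _]]; exact: B13 h h'.
have d14 z : O1 z -> ~ O4 z by move=> [_ [_ [_ h]]] [_ [h' _]]; exact: C14 h h'.
have d23 z : O2 z -> ~ O3 z by move=> [_ [_ [h _]]] [_ [_ [h' _]]]; exact: D23 h h'.
have d24 z : O2 z -> ~ O4 z by move=> [_ [_ [_ h]]] [_ [_ [h' _]]]; exact: E24 h h'.
have d34 z : O3 z -> ~ O4 z by move=> [_ [_ [_ h]]] [_ [_ [_ h']]]; exact: F34 h h'.
have O1x : O1 x by []. have O2g : O2 (rng g) by [].
have O3v : O3 (rng v) by []. have O4u : O4 (rng u) by [].
have svr : src v <> rng v by rewrite sv; exact: nesym.
have sur : src u <> rng u by rewrite su; exact: nesym.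
have [|b1 [Fb1 bb1 b1v mb1]] := swap_exists good svr oO1 oO3 _ O3v; first by rewrite sv.
have [|b2 [Fb2 bb2 b2u mb2]] := swap_exists good sur oO2 oO4 _ O4u; first by rewrite su.
have b12 : b1 \o b2 = b2 \o b1.
  apply: (disjoint_moved_commute (full_inj good Fb1) (full_inj good Fb2)).
  by move=> z /mb1 [h|h] /mb2 [h'|h'];
    [exact: d12 h h'|exact: d14 h h'|exact: d23 h' h|exact: d34 h h'].
pose b := b1 \o b2.
have Fb : full_group X b by exact: full_comp.
have bb : b \o b = id.
  by rewrite /b {1}b12; apply/funext => z /=; rewrite (compK bb1) (compK bb2).
have bx : b x = rng v.
  rewrite /b /= (@notin_moved _ b2 x) -?(germ_at b1v) ?sv //.
  by move=> /mb2 [|]; [exact: d12 | exact: d14].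
have bg : b (rng g) = rng u.
  rewrite /b b12 /= (@notin_moved _ b1 (rng g)) -?(germ_at b2u) ?su //.
  by move=> /mb1 [h|]; [exact: d12 h O2g | exact: d23].
have cb := full_continuous good Fb.
have sgr : src g <> rng g by rewrite sg; exact: nesym.
(* Shrinking by preimages under [b] makes [b] carry [moved a] into [O3] and [O4], off itself. *)
have [||||a [Fa aa ag ma]] := @swap_exists _ _ good g (O1 `&` b @^-1` O3) (O2 `&` b @^-1` O4) sgr.
- by apply: openI => //; exact: open_preimage.
- by apply: openI => //; exact: open_preimage.
- by rewrite sg; split; rewrite //= bx.
- by split; rewrite //= bg.
have [|ff _ _] := commutator_disjoint aa bb.
  move=> z /ma [[_ h]|[_ h]] /ma [[h' _]|[h' _]].
  - exact: d13 h' h.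
  - exact: d23 h' h.
  - exact: d14 h' h.
  - exact: d24 h' h.
exists (a \o b \o a \o b); split=> //.
- exact: commutator_derived.
- have av : a (rng v) = rng v.
    by apply: notin_moved => /ma [[h _]|[h _]]; [exact: d13 h O3v | exact: d23 h O3v].
  by rewrite /= bx av -bx (compK bb) -{1}sg (germ_at ag).
- have /closure_id clKE := clK; apply: (@subset_trans _ K); last by move=> z /KB [].
  rewrite clKE; apply: closure_subset => z; apply: contra_notP => nK.
  apply: (commutator_fixed (x := z) aa bb); apply: notin_moved.
  + by move=> /ma [[[]]|[[]]].
  + move=> m; have [/mb1|/mb2] : moved b1 z \/ moved b2 z.
      apply: contrapT => /not_orP [e1 e2]; apply: m.
      by rewrite /b /= (notin_moved e2) (notin_moved e1).
    * by case=> -[].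
    * by case=> -[].
Qed.

(** As [C] is clopen, gluing [f] on [C] with the identity off [C] produces only germs of [f] and of
    the identity. *)
Lemma full_restrict f C : full_group X f -> f \o f = id -> compact C -> open C ->
  (forall x, C x -> C (f x)) -> exists a, [/\ full_group X a, a \o a = id,
    forall x, C x -> a x = f x & forall x, ~ C x -> a x = x].
Proof.
move=> Ff ff cC oC Cf.
have /choice [a aP] : forall x, exists y, (C x -> y = f x) /\ (~ C x -> y = x).
  by move=> x; have [Cx|n] := pselect (C x); [exists (f x) | exists x].
have aC x : C x -> a x = f x by apply: (aP x).1.
have aN x : ~ C x -> a x = x by apply: (aP x).2.
have aa : a \o a = id.
  apply/funext => x /=; have [Cx|n] := pselect (C x); last by rewrite !aN.
  by rewrite (aC x) // aC ?(compK ff) //; exact: Cf.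
have mC : moved a `<=` C by move=> x; apply: contra_notP => /aN.
exists a; split=> //; apply/(full_groupP good); split.
- by exists a; exact: involution_pair.
- by move=> x m; apply: (full_moved good Ff); rewrite /moved /= -aC //; exact: mC.
- by exists C.
- move=> x Ux; have [Cx|n] := pselect (C x).
    have [g e Hg] := full_germ good Ff Ux; exists g => //.
    by apply: (germ_local et oC) Hg => [|y /aC //]; rewrite e.
  exists x; first exact: src_unit.
  apply: (germ_fixed et Ux (O := ~` C)) => //; last by move=> y /aN.
  by apply: closed_openC; exact: compact_closed.
Qed.

(* [b] commutes with [t] and moves a small [t]-invariant set [C] off itself, so
   the commutator of [b] with the restriction [a] of [t] to [C] coincides with [t] on
   [C] and on [b C], and is trivial elsewhere. *)
Lemma local_part_exists t x B : full_group X t -> t \o t = id -> t x <> x ->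
  open B -> B x -> exists s, [/\ derived_set X s, s <> id, s \o s = id,
    local_at t s & moved s `<=` B `|` t @^-1` B].
Proof.
move=> Ft tt tx oB Bx; have Ux : units x by exact: (full_moved good Ft).
have ct := full_continuous good Ft.
have [A1 [A2 [oA1 oA2 A1x A2x A12]]] := separate hG (nesym tx).
(* Chosen so that [B'] is disjoint from its image under [t]. *)
pose B' := B `&` (A1 `&` t @^-1` A2).
have oB' : open B' by apply: openI => //; apply: openI => //; exact: open_preimage.
have B'x : B' x by [].
have tB' z : B' z -> ~ B' (t z) by move=> [_ [_ h]] [_ [h' _]]; exact: A12 h' h.
have [v [sv B'v vn]] := orbit_avoid good [:: x] Ux Ux oB' B'x.
have vx : rng v <> x by apply: vn; rewrite inE.
have svr : src v <> rng v by rewrite sv; exact: nesym.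
have [D1 [D2 [oD1 oD2 D1x D2v D12]]] := separate hG (nesym vx).
have [||||b0 [Fb0 bb0 b0v mb0]] := @swap_exists _ _ good v (B' `&` D1) (B' `&` D2) svr.
- exact: openI.
- exact: openI.
- by rewrite sv.
- by [].
have mb0' z : moved b0 z -> B' z by move=> /mb0 [[]|[]].
(* The mirror image of [b0] under [t]; it is supported in [t B'], so [b0 \o b1] is an involution
   commuting with [t]. *)
pose b1 := t \o b0 \o t.
have mb1 z : moved b1 z -> B' (t z).
  by move=> m; apply: mb0' => e; apply: m; rewrite /b1 /= e (compK tt).
have Fb1 : full_group X b1 by exact: (full_comp good Ft (full_comp good Fb0 Ft)).
have bb1 : b1 \o b1 = id.
  by apply/funext => z; rewrite /b1 /= (compK tt) (compK bb0) (compK tt).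
have b01 : b0 \o b1 = b1 \o b0.
  apply: (disjoint_moved_commute (full_inj good Fb0) (full_inj good Fb1)).
  by move=> z /mb0' h /mb1; exact: tB'.
pose b := b0 \o b1.
have Fb : full_group X b by exact: full_comp.
have bb : b \o b = id.
  by rewrite /b {1}b01; apply/funext => z /=; rewrite (compK bb0) (compK bb1).
have bt z : b (t z) = t (b z).
  by rewrite /b {1}b01.
have bB' z : B' z -> b z = b0 z.
  by move=> h; rewrite /b /= (@notin_moved _ b1) // => /mb1; exact: tB'.
have b0x : b0 x = rng v by rewrite -(germ_at b0v) sv.
have cb0 := full_continuous good Fb0.
(* [b0] sends [K] from [D1] into [D2] within [B'], hence off both [K] and [t K]. *)
have [||K [cK oK clK Kx KB]] := compact_open_unit good Ux
  (B := (B' `&` D1) `&` b0 @^-1` (B' `&` D2)).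
- by apply: openI; [exact: openI | apply: open_preimage => //; exact: openI].
- by split; rewrite //= b0x.
have cC : compact (K `|` t @` K).
  by apply: compactU => //; apply: continuous_compact => //; exact: continuous_subspaceT.
have tKE : t @` K = t @^-1` K.
  apply/seteqP; split => [_ [z Kz <-]|z Kz]; first by rewrite /= (compK tt).
  by exists (t z); rewrite // (compK tt).
rewrite tKE in cC.
have [||a [Fa aa aC aN]] := full_restrict Ft tt cC.
- by apply: openU => //; exact: open_preimage.
- by move=> z [h|h]; [right; rewrite /= (compK tt) | left].
have ma z : moved a z -> (K `|` t @^-1` K) z by apply: contra_notP => /aN.
have Kb z : K z -> ~ (K `|` t @^-1` K) (b z).
  move=> Kz; have [[[B'z D1z] [B'b D2b]] _] := KB _ Kz.
  rewrite bB' // => -[/KB [[[_ D1b] _] _]|/KB [[[h _] _] _]]; first exact: D12 D1b D2b.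
  exact: tB' h.
have [|ff _ lf] := commutator_disjoint aa bb.
  move=> z /ma [Kz|Kz] /ma; first exact: Kb Kz.
  by move=> h; apply: (Kb _ Kz); rewrite bt; case: h => h; [right; rewrite /= (compK tt) | left].
have la z : a z = z \/ a z = t z.
  by have [/aC|/aN] := pselect ((K `|` t @^-1` K) z); [right | left].
exists (a \o b \o a \o b); split=> //.
- exact: commutator_derived.
- move=> /(congr1 (@^~ x)) /=; rewrite (aN (b x)); last exact: Kb.
  by rewrite (compK bb) aC //; left.
- move=> z; case: (lf z) => ->; first exact: la.
  by case: (la (b z)) => ->; [left | right; rewrite bt]; rewrite (compK bb).
- move=> z; apply: contra_notP => /not_orP [n1 n2].
  apply: (commutator_fixed (x := z) aa bb); apply: notin_moved.
  + by move=> /ma [/KB [[[[]]]]|/KB [[[[]]]]].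
  + move=> m; apply: m; rewrite /b /= (@notin_moved _ b1 z) ?(@notin_moved _ b0 z) //.
      by move=> /mb0' [].
    by move=> /mb1 [].
Qed.

(** Existence clauses are witnessed in the commutator subgroup and pass upwards; properties of
    single elements hold in the full group and pass downwards. *)
Lemma intermediate_rich Gam : fun_subgroup Gam -> derived_set X `<=` Gam ->
  Gam `<=` full_group X -> locally_rich units Gam.
Proof.
move=> gr DG GF; split=> //.
- by move=> f /GF; exact: full_continuous.
- by move=> f /GF /(closure_moved_full good) [].
- by move=> f /GF /(closure_moved_full good) [].
- by move=> f /GF /(closure_moved_full good) [].
- move=> x B Ux oB Bx; have [f [/DG ? ? ? ?]] := involution_exists Ux oB Bx.
  by exists f.
- move=> t x B /GF Ft tt tx oB Bx.
  by have [s [/DG ? ? ? ? ?]] := local_part_exists Ft tt tx oB Bx; exists s.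
- move=> x B Ux oB Bx.
  have [g [sg Bg gn]] := orbit_avoid good [:: x] Ux Ux oB Bx.
  have gx : rng g <> x by apply: gn; rewrite inE.
  have [||f [/DG ? _ ? ?]] := @three_cycle g B _ oB _ Bg; last by exists f.
    by rewrite sg; exact: nesym.
  by rewrite sg.
Qed.

End DerivedElements.

(** * Reconstruction of the groupoid *)

Section Reconstruction.
Context {G1 G2 : topologicalType} (X1 : groupoid_data G1) (X2 : groupoid_data G2).
Variables (Gam1 : set (G1 -> G1)) (Gam2 : set (G2 -> G2)).
Variables (phi : (G1 -> G1) -> G2 -> G2) (psi : (G2 -> G2) -> G1 -> G1).
Hypotheses (good1 : good_groupoid X1) (good2 : good_groupoid X2).
Hypotheses (gr1 : fun_subgroup Gam1) (gr2 : fun_subgroup Gam2).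
Hypotheses (DG1 : derived_set X1 `<=` Gam1) (GF1 : Gam1 `<=` full_group X1).
Hypotheses (DG2 : derived_set X2 `<=` Gam2) (GF2 : Gam2 `<=` full_group X2).
Hypothesis iso : mutual_iso Gam1 Gam2 phi psi.

Let et1 : etale X1. Proof. by case: good1 => _ []. Qed.
Let et2 : etale X2. Proof. by case: good2 => _ []. Qed.
Let gpd1 := etale_groupoid et1.
Let gpd2 := etale_groupoid et2.
Let h1 : hausdorff_space G1. Proof. by case: good1. Qed.
Let h2 : hausdorff_space G2. Proof. by case: good2. Qed.
Let r1 := intermediate_rich good1 gr1 DG1 GF1.
Let r2 := intermediate_rich good2 gr2 DG2 GF2.
Let osi := mutual_iso_sym iso.

Local Notation match12 := (matching (unit_space X1) (unit_space X2) Gam1 phi).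
Local Notation match21 := (matching (unit_space X2) (unit_space X1) Gam2 psi).

(* The graph of the isomorphism: the arrow of germ [f] at [x] is sent to the
   arrow of germ [phi f] at the point matching [x]. *)
Definition arrow_matching g g' := exists f, [/\ Gam1 f, germ X1 f g, germ X2 (phi f) g' &
  match12 (gsrc X1 g) (gsrc X2 g')].

Let m_sym x y : match12 x y -> match21 y x.
Proof. exact: (matching_sym h1 h2 r1 r2 iso). Qed.

Let m_fun x y y' : match12 x y -> match12 x y' -> y = y'.
Proof. exact: (matching_functional h1 h2 r1 r2 iso). Qed.

Let m_inj x x' y : match12 x y -> match12 x' y -> x = x'.
Proof. by move=> /m_sym a /m_sym; apply: (matching_functional h2 h1 r2 r1 osi a). Qed.

Let m_equiv f x y : Gam1 f -> match12 x y -> match12 (f x) (phi f y).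
Proof. exact: (matching_equivariant r1 r2 iso). Qed.

Lemma arrow_matching_rng g g' : arrow_matching g g' -> match12 (grng X1 g) (grng X2 g').
Proof.
by move=> [f [Gf Hg Hg' /(m_equiv Gf)]]; rewrite (germ_at Hg) (germ_at Hg').
Qed.

Lemma arrow_matching_total g : exists g', arrow_matching g g'.
Proof.
have [f Df fg] := derived_germ good1 g; have Gf := DG1 Df.
have [y xy] := matching_total h1 h2 r1 r2 iso (unit_src gpd1 g).
have Uy : unit_space X2 y by case: xy.
have [g' e Hg'] := full_germ good2 (GF2 (iso_fwd iso Gf)) Uy.
by exists g', f; rewrite e.
Qed.

(** Two elements with germ [g] agree near its source, so by equivariance their images under [phi]
    agree on units near the matching point, and [germ_unique] applies. *)
Lemma arrow_matching_functional g g1 g2 :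
  arrow_matching g g1 -> arrow_matching g g2 -> g1 = g2.
Proof.
move=> [f1 [Gf1 Hg1 Hg1' m1]] [f2 [Gf2 Hg2 Hg2' m2]].
have e := m_fun m1 m2.
have [O [oO Og ff]] := germ_agree et1 Hg1 Hg2.
have [A [oA Ag mA]] := matching_continuous h2 h1 r2 r1 osi (m_sym m1) oO Og.
have eff2 : effective X2 by case: good2.
apply: (germ_unique et2 eff2 _ Hg1' Hg2' e (openI oA (open_units et2)) _ _).
- by apply: full_inj good2 _ _; apply: GF2; exact: (iso_fwd iso).
- by split=> //; exact: unit_src.
move=> y [Ay Uy]; have [x yx] := matching_total h2 h1 r2 r1 osi Uy.
have xy := matching_sym h2 h1 r2 r1 osi yx.
apply: m_fun (m_equiv Gf1 xy) _; rewrite (ff x) //; first exact: m_equiv.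
exact: mA yx.
Qed.

Lemma arrow_matching_comp g h g' h' : arrow_matching g g' -> arrow_matching h h' ->
  gcomp X1 g h <-> gcomp X2 g' h'.
Proof.
move=> [f [_ _ _ m]] /arrow_matching_rng m'.
split=> /gcompP e; apply/gcompP => //.
- by rewrite (e gpd1) in m; exact: m_fun m m'.
- by rewrite (e gpd2) in m; exact: m_inj m m'.
Qed.

Lemma arrow_matching_mul g h g' h' : arrow_matching g g' -> arrow_matching h h' ->
  gcomp X1 g h -> arrow_matching (gmul X1 g h) (gmul X2 g' h').
Proof.
move=> R R' gh; have gh' := (arrow_matching_comp R R').1 gh.
case: R R' => [f [Gf Hg Hg' _]] [k [Gk Hh Hh' m]].
exists (f \o k); split.
- exact: rich_comp r1 _ _ Gf Gk.
- exact: germ_mul.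
- by rewrite (iso_comp iso) //; exact: germ_mul.
- by rewrite !gsrcM.
Qed.

(** The same [f] serves for all arrows near [g], so continuity reduces to that of the matching of
    sources; the image arrow is then fixed by functionality. *)
Lemma arrow_matching_continuous g g' B : arrow_matching g g' -> open B -> B g' ->
  exists A, [/\ open A, A g & forall k k', A k -> arrow_matching k k' -> B k'].
Proof.
move=> [f [Gf Hg Hg' m]] oB Bg'.
have [W [oW Wg _ HW]] := germ_open Hg.
have [W' [oW' Wg' _ HW']] := germ_open Hg'.
have [||A [oA Ag mA]] := matching_continuous h1 h2 r1 r2 iso m
  (B := gsrc X2 @` (W' `&` B)).
- by apply: src_open => //; exact: openI.
- by exists g'.
exists (W `&` gsrc X1 @^-1` A); split=> //.
  by apply: openI => //; exact: open_preimage (src_continuous et1) oA.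
move=> k k' [Wk Ak] R; have [_ [_ _ _ mk]] := R.
have [k'' [Wk'' Bk''] e] := mA _ _ Ak mk.
suff <- : k'' = k' by [].
apply: arrow_matching_functional R; exists f; split=> //; first exact: HW.
  exact: HW'.
by rewrite e.
Qed.

End Reconstruction.

Lemma arrow_matching_sym {G1 G2 : topologicalType} (X1 : groupoid_data G1)
    (X2 : groupoid_data G2) Gam1 Gam2 phi psi g g' :
  good_groupoid X1 -> good_groupoid X2 ->
  locally_rich (unit_space X1) Gam1 -> locally_rich (unit_space X2) Gam2 ->
  mutual_iso Gam1 Gam2 phi psi ->
  arrow_matching X1 X2 Gam1 phi g g' -> arrow_matching X2 X1 Gam2 psi g' g.
Proof.
move=> [_ _ _ h1 _] [_ _ _ h2 _] r1 r2 iso [f [Gf Hg Hg' m]]; exists (phi f); split=> //.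
- exact: (iso_fwd iso).
- by rewrite (iso_fwdK iso).
- exact: (matching_sym h1 h2 r1 r2 iso).
Qed.

Lemma intermediate_iso_groupoid_iso {G1 G2 : topologicalType} (X1 : groupoid_data G1)
    (X2 : groupoid_data G2) (Gam1 : set (G1 -> G1)) (Gam2 : set (G2 -> G2)) :
  good_groupoid X1 -> good_groupoid X2 ->
  fun_subgroup Gam1 -> derived_set X1 `<=` Gam1 -> Gam1 `<=` full_group X1 ->
  fun_subgroup Gam2 -> derived_set X2 `<=` Gam2 -> Gam2 `<=` full_group X2 ->
  group_iso Gam1 Gam2 -> groupoid_iso X1 X2.
Proof.
move=> good1 good2 gr1 D1 F1 gr2 D2 F2 /(group_iso_mutual gr1 gr2) [phi [psi iso]].
have osi := mutual_iso_sym iso.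
have r1 := intermediate_rich good1 gr1 D1 F1.
have r2 := intermediate_rich good2 gr2 D2 F2.
have sym12 := arrow_matching_sym good1 good2 r1 r2 iso.
have sym21 := arrow_matching_sym good2 good1 r2 r1 osi.
have fun12 := arrow_matching_functional good1 good2 gr1 gr2 D1 F1 D2 F2 iso.
have fun21 := arrow_matching_functional good2 good1 gr2 gr1 D2 F2 D1 F1 osi.
have /choice [Phi PhiP] := arrow_matching_total good1 good2 gr1 gr2 D1 F1 D2 F2 iso.
have /choice [Psi PsiP] := arrow_matching_total good2 good1 gr2 gr1 D2 F2 D1 F1 osi.
exists Phi, Psi; split.
- by split=> g; [exact: fun21 (PsiP _) (sym12 _ _ (PhiP g))
    | exact: fun12 (PhiP _) (sym21 _ _ (PsiP g))].
- move=> g O /open_subset_nbhs [B [oB Bg BO]].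
  have [A [oA Ag AB]] := arrow_matching_continuous good1 good2 gr1 gr2 D1 F1 D2 F2
    iso (PhiP g) oB Bg.
  change (nbhs g (Phi @^-1` O)).
  by apply: filterS (open_nbhs_nbhs (conj oA Ag)) => k Ak; apply/BO/(AB _ _ Ak).
- move=> g O /open_subset_nbhs [B [oB Bg BO]].
  have [A [oA Ag AB]] := arrow_matching_continuous good2 good1 gr2 gr1 D2 F2 D1 F1
    osi (PsiP g) oB Bg.
  change (nbhs g (Psi @^-1` O)).
  by apply: filterS (open_nbhs_nbhs (conj oA Ag)) => k Ak; apply/BO/(AB _ _ Ak).
- move=> g h.
  exact: (arrow_matching_comp good1 good2 gr1 gr2 D1 F1 D2 F2 iso (PhiP g) (PhiP h)).
- move=> g h gh; apply: fun12 (PhiP _) _.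
  exact: (arrow_matching_mul good1 good2 gr1 gr2 D1 F1 D2 F2 iso (PhiP g) (PhiP h) gh).
Qed.

(** * Conjugating full groups by a groupoid isomorphism *)

Section Transport.
Context {G1 G2 : topologicalType} (X1 : groupoid_data G1) (X2 : groupoid_data G2).
Variables (Phi : G1 -> G2) (Psi : G2 -> G1).
Hypotheses (good1 : good_groupoid X1) (good2 : good_groupoid X2).
Hypotheses (PhiK : cancel Phi Psi) (PsiK : cancel Psi Phi).
Hypotheses (cPhi : continuous Phi) (cPsi : continuous Psi).
Hypothesis Phi_comp : forall g h, gcomp X1 g h <-> gcomp X2 (Phi g) (Phi h).
Hypothesis Phi_mul : forall g h, gcomp X1 g h -> Phi (gmul X1 g h) = gmul X2 (Phi g) (Phi h).

Let et1 : etale X1. Proof. by case: good1 => _ []. Qed.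
Let et2 : etale X2. Proof. by case: good2 => _ []. Qed.
Let gpd1 := etale_groupoid et1.
Let gpd2 := etale_groupoid et2.

(** Only products are assumed to be preserved, so the source is recovered by cancelling [Phi g] in
    the image of [g (src g) = g]. *)
Lemma iso_src g : Phi (gsrc X1 g) = gsrc X2 (Phi g).
Proof.
have [c e] := gmul_src gpd1 g; have c' := (Phi_comp _ _).1 c.
by have := gmulKg gpd2 c'; rewrite -Phi_mul // e.
Qed.

Lemma iso_rng g : Phi (grng X1 g) = grng X2 (Phi g).
Proof.
have [c e] := gmul_rng gpd1 g; have c' := (Phi_comp _ _).1 c.
by have := gmulgK gpd2 c'; rewrite -Phi_mul // e.
Qed.

Lemma full_group_conj f : full_group X1 f -> full_group X2 (Phi \o f \o Psi).
Proof.
move=> /(full_groupP good1) [[f' [e1 e2]] m [K cK fK] H].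
have Psi_src g : Psi (gsrc X2 g) = gsrc X1 (Psi g).
  by rewrite -{1}(PsiK g) -iso_src PhiK.
have mPsi y : moved (Phi \o f \o Psi) y -> moved f (Psi y).
  by move=> n e; apply: n; rewrite /= e PsiK.
have unit_Psi y : unit_space X2 y -> unit_space X1 (Psi y).
  by move=> /(src_unit gpd2) <-; rewrite Psi_src; exact: unit_src.
apply/(full_groupP good2); split.
- exists (Phi \o f' \o Psi); split; apply/funext => y /=.
    by rewrite PhiK (compK e1) PsiK.
  by rewrite PhiK (compK e2) PsiK.
- move=> y /mPsi /m /(src_unit gpd1) e.
  by rewrite -(PsiK y) -e iso_src; exact: unit_src.
- exists (Phi @` K).
    by apply: continuous_compact => //; exact: continuous_subspaceT.
  by move=> y /mPsi /fK Ky; exists (Psi y).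
- move=> y /unit_Psi /H [g e Hg]; exists (Phi g); first by rewrite -iso_src e PsiK.
  have [W [oW Wg HW _]] := germ_open Hg.
  apply: (@open_germ _ X2 _ (Psi @^-1` W)).
  + exact: open_preimage cPsi oW.
  + by rewrite /= PhiK.
  + by move=> k Wk; rewrite /= Psi_src (HW _ Wk) iso_rng PsiK.
Qed.

Lemma derived_conj f : derived_set X1 f -> derived_set X2 (Phi \o f \o Psi).
Proof.
have conjM u v : (Phi \o u \o Psi) \o (Phi \o v \o Psi) = Phi \o (u \o v) \o Psi.
  by apply/funext => y /=; rewrite PhiK.
have conj1 u : u = id -> Phi \o u \o Psi = id.
  by move=> ->; apply/funext => y /=; rewrite PsiK.
elim=> {f} [|a b a' b' Fa Fb e1 e2 e3 e4|f g _ Df _ Dg|f f' _ Df e1 e2].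
- by rewrite conj1 //; exact: dfg_id.
- rewrite -(conjM (a' \o b' \o a)) -(conjM (a' \o b')) -(conjM a').
  apply: dfg_comm; try exact: full_group_conj; by rewrite conjM conj1.
- by rewrite -(conjM f g); exact: dfg_mul.
- by apply: dfg_inv Df _ _; rewrite conjM conj1.
Qed.

End Transport.

Lemma groupoid_iso_group_iso {G1 G2 : topologicalType} (X1 : groupoid_data G1)
    (X2 : groupoid_data G2) : good_groupoid X1 -> good_groupoid X2 ->
  groupoid_iso X1 X2 ->
  group_iso (full_group X1) (full_group X2) /\ group_iso (derived_set X1) (derived_set X2).
Proof.
move=> good1 good2 [Phi [Psi [[PhiK PsiK] cPhi cPsi comp mul]]].
have comp' g h : gcomp X2 g h <-> gcomp X1 (Psi g) (Psi h) by rewrite comp !PsiK.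
have mul' g h : gcomp X2 g h -> Psi (gmul X2 g h) = gmul X1 (Psi g) (Psi h).
  by move=> /comp' /mul; rewrite !PsiK => <-.
(* Conjugation by [Phi] is the isomorphism in both cases; only the stability of the two sets under
   it distinguishes them. *)
suff iso (H1 : set (G1 -> G1)) (H2 : set (G2 -> G2)) :
    (forall f, H1 f -> H2 (Phi \o f \o Psi)) -> (forall f, H2 f -> H1 (Psi \o f \o Phi)) ->
    group_iso H1 H2.
  split; apply: iso => f.
  - exact: full_group_conj.
  - exact: full_group_conj.
  - exact: derived_conj.
  - exact: derived_conj.
move=> H12 H21; exists (fun f => Phi \o f \o Psi); split=> //.
- move=> f g _ _ e; apply/funext => x.
  have /(congr1 Psi) /= := congr1 (@^~ (Phi x)) e.
  by rewrite !PhiK.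
- move=> h /H21 Hh; exists (Psi \o h \o Phi); split=> //.
  by apply/funext => y /=; rewrite !PsiK.
- by move=> f g _ _; apply/funext => y /=; rewrite PhiK.
Qed.

Theorem theorem7p2 (G1 G2 : topologicalType)
  (X1 : groupoid_data G1) (X2 : groupoid_data G2) :
  good_groupoid X1 -> good_groupoid X2 ->
  (forall (Gam1 : set (G1 -> G1)) (Gam2 : set (G2 -> G2)),
      fun_subgroup Gam1 -> derived_set X1 `<=` Gam1 -> Gam1 `<=` full_group X1 ->
      fun_subgroup Gam2 -> derived_set X2 `<=` Gam2 -> Gam2 `<=` full_group X2 ->
      group_iso Gam1 Gam2 -> groupoid_iso X1 X2) /\
  ((groupoid_iso X1 X2 <-> group_iso (full_group X1) (full_group X2)) /\
   (group_iso (full_group X1) (full_group X2) <->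
    group_iso (derived_set X1) (derived_set X2))).
Proof.
move=> good1 good2.
have main := intermediate_iso_groupoid_iso good1 good2.
have transport := groupoid_iso_group_iso good1 good2.
(* The full group and its commutator subgroup are the two extreme intermediate groups, so each of
   them determines the groupoid; the two group isomorphisms are then compared through the
   groupoids. *)
have full_main : group_iso (full_group X1) (full_group X2) -> groupoid_iso X1 X2.
  by apply: main => //; [exact: full_subgroup | exact: derived_full | exact: full_subgroup
    | exact: derived_full].
have derived_main : group_iso (derived_set X1) (derived_set X2) -> groupoid_iso X1 X2.
  by apply: main => //; [exact: derived_subgroup | exact: derived_full
    | exact: derived_subgroup | exact: derived_full].
split; first by move=> Gam1 Gam2; exact: main.
split; split.
- by move=> /transport [].
- exact: full_main.
- by move=> /full_main /transport [].
- by move=> /derived_main /transport [].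
Qed.
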